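(* Let $f$ be a weakly biased random multiplicative function such that, for some fixed $0<\alpha<1/2$, $\mathbb{E} f(p)=-\frac{\delta_p}{p^{\alpha}}$ for every prime $p$, where $0\le\delta_p\le1$. Then almost surely $M_f(x)=o(x^{1-\alpha+\epsilon})$ for all $\epsilon>0$. If in addition $\limsup_{p}\delta_p<1$ and $\sum_{p\in\mathcal{P}}\frac{\delta_p}{p}=\infty$, then almost surely $M_f(x)$ is not $o(x^{1-\alpha-\epsilon})$ for any $\epsilon>0$.
   Context: $\mathcal{P}$ denotes the set of primes and $\mu$ the Möbius function. A random multiplicative function is a random function $f:\mathbb{N}\times\Omega\to\{-1,0,1\}$ with $f(1)=1$, $f(n)=|\mu(n)|\prod_{p\mid n}f(p)$ for $n\ge2$, where $\{f(p)\}_{p\in\mathcal{P}}$ are independent $\pm1$-valued random variables. $f$ is biased if $\mathbb{E} f(p)<0$ for all primes $p$; it is weakly biased if it is biased and $\sum_{p\in\mathcal{P}} f(p)/p$ converges almost surely. $M_f(x):=\sum_{n\le x}f(n)$. *)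

(* Defs.v *)
From HB Require Import structures.
From mathcomp Require Import all_boot all_order all_algebra.
From mathcomp Require Import finmap.
From mathcomp Require Import all_classical all_reals all_analysis.

Set Implicit Arguments.
Unset Strict Implicit.
Unset Printing Implicit Defensive.

Import Order.TTheory GRing.Theory Num.Theory.
Import numFieldNormedType.Exports.

Local Open Scope classical_set_scope.
Local Open Scope ring_scope.

                                                          
Canonical pinfty_filter_on (R : numFieldType) :=
  FilterType (pinfty_nbhs R) (@proper_pinfty_nbhs R).

                                                            
Definition mobius (n : nat) : int :=
  if all (fun p => logn p n == 1%N) (primes n) then (-1) ^+ size (primes n)
  else 0.

Section RandomMultiplicative.
Context (d : measure_display) (T : measurableType d) (R : realType).
Variable P : probability T R.

Definition mutually_independent (I : choiceType) (D : set I)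
    (X : I -> {RV P >-> R}) : Prop :=
  forall s : {fset I}, [set` s] `<=` D ->
  forall A : I -> set R, (forall i, i \in s -> measurable (A i)) ->
  P (\bigcap_(i in [set` s]) (X i @^-1` A i)) =
  (\prod_(i <- s) P (X i @^-1` A i))%E.

                                                                      
             
Record random_multiplicative (f : nat -> {RV P >-> R}) : Prop := {
  rmf_pm1 : forall p, prime p -> forall w, f p w = 1 \/ f p w = -1 ;
  rmf_indep : mutually_independent [set p | prime p] f ;
  rmf_one : forall w, f 1%N w = 1 ;
  rmf_mul : forall n, (2 <= n)%N -> forall w,
    f n w = `|mobius n|%:~R * \prod_(p <- primes n) f p w }.

Definition biased (f : nat -> {RV P >-> R}) : Prop :=
  forall p, prime p -> ('E_P[f p] < 0)%E.

Definition weakly_biased (f : nat -> {RV P >-> R}) : Prop :=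
  biased f /\
  {ae P, forall w,
     cvgn (fun n => \sum_(0 <= p < n | prime p) f p w / p%:R)}.

Definition partial_sum (f : nat -> {RV P >-> R}) (w : T) (x : R) : R :=
  \sum_(1 <= n < (Num.truncn x).+1) f n w.

End RandomMultiplicative.

(* Main.v *)
Require Import Defs.
From HB Require Import structures.
From mathcomp Require Import all_boot all_order all_algebra.
From mathcomp Require Import finmap ring lra.
From mathcomp Require Import all_classical all_reals all_analysis.
From mathcomp Require Import measurable_realfun.

Set Implicit Arguments.
Unset Strict Implicit.
Unset Printing Implicit Defensive.

Import Order.TTheory GRing.Theory Num.Theory.
Import numFieldNormedType.Exports.

Local Open Scope classical_set_scope.
Local Open Scope ring_scope.

(** The second moment [sum_{m,n} |E f(m) f(n)| (mn)^{-s}], taken over squarefree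
    [y]-smooth [m, n], factors as the Euler product of
    [1 + 2 |E f(p)| p^{-s} + p^{-2s}], hence is bounded in [y] for
    [s > 1 - alpha].  As absolute values are taken, the bound survives
    restriction to dyadic blocks, so chaining over binary expansions
    (Rademacher-Menshov) controls [E max_{N <= 2^k} M_f(N)^2], and Borel-Cantelli
    gives the upper bound.

    For the lower bound let [S_y(s) = prod_{p <= y} (1 + f(p) p^{-s})] and
    [T_y(s) = sum_{n <= y} f(n) n^{-s}].  The second moment also gives
    [S_y(s) - T_y(s) -> 0] along [y = 2^j], almost surely for each
    [s > 1 - alpha].  At [s = 1 - alpha + eta] one has
    [S_y(s) = exp (O(1) - sum_{p <= y} delta_p p^{-1-eta})], since the centered
    variables contribute a bounded random series.  Divergence of
    [sum delta_p / p] makes this small as [eta -> 0], while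
    [limsup delta_p < 1] keeps it above a multiple of [eta^c] with [c < 1].
    If [M_f(x) = o(x^{1-alpha-eps})], Abel summation makes [T_y] Lipschitz
    near [1 - alpha], uniformly in [y], so that the limit would be
    [O(eta)]: a contradiction. *)

(** * Powers and Abel summation *)

Section RealPowers.
Context {R : realType}.
Implicit Types (a w : nat -> R) (s t : R).

(** This is [1 + u <= expR u] at [u = t * ln (y / x)]. The exponent has either sign; the estimates
    below take it negative. *)
Lemma powR_tangent (x y t : R) : 0 < x -> 0 < y ->
  x `^ t * (1 + t * ln (y / x)) <= y `^ t.
Proof.
move=> x0 y0; rewrite ln_div ?posrE// mulrBr.
rewrite /powR !gt_eqF//.
have -> : expR (t * ln y) = expR (t * ln x) * expR (t * ln y - t * ln x).
  by rewrite -expRD addrC subrK.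
by rewrite ler_pM2l ?expR_gt0// expR_ge1Dx.
Qed.

Lemma ln_le_subr1 (x : R) : 0 < x -> ln x <= x - 1.
Proof. by move=> x0; rewrite -{1}(subrKC 1 x) le_ln1Dx// ltrBrDr addNr. Qed.

Lemma powR_natD (n : nat) s t :
  n.+1%:R `^ (s + t) = n.+1%:R `^ s * n.+1%:R `^ t :> R.
Proof. by rewrite powRD// pnatr_eq0 implybT. Qed.

Lemma powR_nat_gt0 (n : nat) s : 0 < n.+1%:R `^ s.
Proof. by rewrite powR_gt0. Qed.

Lemma powR_nat_le (n : nat) s t : s <= t -> n.+1%:R `^ s <= n.+1%:R `^ t :> R.
Proof. by move=> st; rewrite ler_powR// ler1n. Qed.

Lemma powR_nat_le1 (n : nat) s : s <= 0 -> n.+1%:R `^ s <= 1 :> R.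
Proof. by move=> s0; rewrite -[leRHS](powRr0 n.+1%:R) powR_nat_le. Qed.

(** Comparison of a term of the zeta series with an integral, in a form that telescopes. *)
Lemma powR_natS_le (n : nat) (eta : R) : 0 < eta ->
  n.+2%:R `^ (- (1 + eta)) <=
  (n.+1%:R `^ (- eta) - n.+2%:R `^ (- eta)) / eta.
Proof.
move=> eta0; rewrite ler_pdivlMr// lerBrDr.
apply: le_trans (@powR_tangent n.+2%:R n.+1%:R (- eta) _ _) => //.
rewrite opprD powR_natD powR_inv1 ?ler0n//.
rewrite mulrDr mulr1 [leLHS]addrC lerD2l mulrAC mulrC.
rewrite ler_wpM2l ?powR_ge0// mulrC mulNr -mulrN ler_wpM2l ?(ltW eta0)//.
rewrite lerNr (le_trans (ln_le_subr1 _))// ?divr_gt0//.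
have h : n.+2%:R = n.+1%:R + 1 :> R by rewrite natr1.
have := ltr0Sn R n.+1; rewrite h => h1.
by rewrite -subr_le0 le_eqVlt; apply/orP; left; apply/eqP; field; lra.
Qed.

Lemma zeta_bound s (N : nat) : 1 < s ->
  \sum_(1 <= n < N) n%:R `^ (- s) <= 1 + (s - 1)^-1.
Proof.
move=> s1; set eta := s - 1; have eta0 : 0 < eta by rewrite /eta; lra.
have -> : s = 1 + eta by rewrite /eta; ring.
(* Keeping the tail of the integral on the right makes the bound inductive. *)
suff H M : \sum_(1 <= n < M.+2) n%:R `^ (- (1 + eta)) <=
    1 + eta^-1 - M.+1%:R `^ (- eta) / eta.
  case: N => [|[|N]].
  - by rewrite big_geq// addr_ge0// invr_ge0 ltW.
  - by rewrite big_geq// addr_ge0// invr_ge0 ltW.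
  - by apply: le_trans (H N) _; rewrite lerBlDr lerDl divr_ge0 ?powR_ge0// ltW.
elim: M => [|M IH].
  by rewrite big_nat1 !powR1 div1r addrK.
rewrite big_nat_recr//=; apply: le_trans (lerD IH (powR_natS_le M eta0)) _.
by rewrite mulrBl; lra.
Qed.

Lemma powR_nat_diff (n : nat) s : 0 <= s ->
  0 <= n.+1%:R `^ (- s) - n.+2%:R `^ (- s) <= s * n.+1%:R `^ (- s - 1).
Proof.
move=> s0; apply/andP; split.
  rewrite subr_ge0 !powRN lef_pV2 ?posrE ?powR_nat_gt0//.
  by rewrite ge0_ler_powR ?nnegrE ?ler0n// ler_nat.
rewrite lerBlDr -lerBlDl.
apply: le_trans (@powR_tangent n.+1%:R n.+2%:R (- s) _ _) => //.
rewrite powR_natD powR_inv1 ?ler0n// mulrDr mulr1 lerD2l mulrCA -mulrN.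
rewrite ler_wpM2l ?powR_ge0// mulNr lerN2 ler_wpM2l//.
rewrite (le_trans (ln_le_subr1 _))// ?divr_gt0//.
have h : n.+2%:R = n.+1%:R + 1 :> R by rewrite natr1.
have := ltr0Sn R n => h1; rewrite h.
by rewrite -subr_le0 le_eqVlt; apply/orP; left; apply/eqP; field; lra.
Qed.

(** [1 - n ^ (- h) <= h * ln n], and the logarithm is traded for [n ^ k / k]. Linearity in [h] is
    the source of the Lipschitz bound below. *)
Lemma onem_powR_le (n : nat) (h k : R) : 0 <= h -> 0 < k ->
  0 <= 1 - n.+1%:R `^ (- h) <= h / k * n.+1%:R `^ k.
Proof.
move=> h0 k0; rewrite subr_ge0 powR_nat_le1 ?oppr_le0//=.
have lnk : ln n.+1%:R <= n.+1%:R `^ k / k :> R.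
  by rewrite ler_pdivlMr// mulrC -ln_powR ltW// ln_sublinear//.
have := @powR_tangent 1 n.+1%:R (- h) ltr01 (ltr0Sn _ _).
rewrite powR1 divr1 mul1r.
have : h * ln n.+1%:R <= h / k * n.+1%:R `^ k.
  by rewrite -mulrA ler_wpM2l// mulrC.
lra.
Qed.

Lemma abel_summation a w (N : nat) :
  \sum_(1 <= n < N.+2) a n * w n =
  (\sum_(1 <= n < N.+2) a n) * w N.+1 +
  \sum_(1 <= n < N.+1) (\sum_(1 <= k < n.+1) a k) * (w n - w n.+1).
Proof.
elim: N => [|N IH]; first by rewrite !big_nat1 big_geq// addr0.
rewrite big_nat_recr//= IH [X in _ = X * _ + _]big_nat_recr//=.
rewrite [X in _ = _ + X]big_nat_recr//=.
ring.
Qed.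

(** Summation by parts: the boundary term costs [C * D], the rest [C * D] times a sum of
    [n ^ (- (1 + k))], which is at most [1 + k^-1]. *)
Lemma abel_bound a w (b k C D : R) : 0 < k -> 0 <= C -> 0 <= D ->
  (forall n, `|\sum_(1 <= i < n.+2) a i| <= C * n.+1%:R `^ b) ->
  (forall n, `|w n.+1| <= D * n.+1%:R `^ (- b)) ->
  (forall n, `|w n.+1 - w n.+2| <= D * n.+1%:R `^ (- b - (1 + k))) ->
  forall N, `|\sum_(1 <= n < N) a n * w n| <= C * D * (2 + k^-1).
Proof.
move=> k0 C0 D0 Ha Hw Hd N.
have CD : 0 <= C * D * (2 + k^-1).
  by rewrite !mulr_ge0// addr_ge0// invr_ge0 ltW.
case: N => [|[|N]]; [by rewrite big_geq// normr0|by rewrite big_geq// normr0|].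
rewrite abel_summation; apply: le_trans (ler_normD _ _) _.
have -> : C * D * (2 + k^-1) = C * D + C * D * (1 + (1 + k - 1)^-1).
  by rewrite [1 + k]addrC addrK; ring.
apply: lerD.
  rewrite normrM; apply: le_trans (ler_pM _ _ (Ha N) (Hw N)) _ => //.
  by rewrite mulrACA -powR_natD subrr powRr0 mulr1.
apply: le_trans (ler_norm_sum _ _ _) _.
have k1 : 1 < 1 + k by lra.
apply: le_trans (ler_wpM2l (mulr_ge0 C0 D0) (zeta_bound N.+1 k1)).
rewrite mulr_sumr !big_nat; apply: ler_sum => -[//|n] _.
rewrite normrM; apply: le_trans (ler_pM _ _ (Ha n) (Hd n)) _ => //.
by rewrite mulrACA -powR_natD addrA subrr sub0r.
Qed.

Lemma abel_powR a (b s0 C : R) : 0 <= C -> 0 <= s0 -> b < s0 ->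
  (forall n, `|\sum_(1 <= i < n.+2) a i| <= C * n.+1%:R `^ b) ->
  exists K : R, forall N s, s0 <= s <= s0 + 1 ->
    `|\sum_(1 <= n < N) a n * n%:R `^ (- s)| <= K.
Proof.
move=> C0 s00 bs Ha; exists (C * (s0 + 1) * (2 + (s0 - b)^-1)) => N s /andP[s0s ss].
apply: (@abel_bound _ (fun n => n%:R `^ (- s)) b (s0 - b)) => //=.
- by rewrite subr_gt0.
- by rewrite addr_ge0.
- move=> n; rewrite ger0_norm ?powR_ge0//.
  rewrite -[leLHS]mul1r ler_pM ?powR_ge0 ?powR_nat_le//; lra.
- move=> n; have s1 : 0 <= s by lra.
  have /andP[d0 d1] := powR_nat_diff n s1.
  rewrite ger0_norm//; apply: le_trans d1 _.
  rewrite ler_pM ?powR_ge0 ?powR_nat_le//; lra.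
Qed.

Lemma abel_powR_lipschitz a (b s0 C : R) : 0 <= C -> 0 <= s0 -> b < s0 ->
  (forall n, `|\sum_(1 <= i < n.+2) a i| <= C * n.+1%:R `^ b) ->
  exists L : R, forall N s h, s0 <= s <= s0 + 1 -> 0 <= h ->
    `|\sum_(1 <= n < N) a n * (n%:R `^ (- s) - n%:R `^ (- (s + h)))| <= L * h.
Proof.
(* Half of the gap [s0 - b] pays for the factor [n ^ k] of [onem_powR_le], the other half for
   convergence. *)
move=> C0 s00 bs Ha; pose k := (s0 - b) / 2.
have k0 : 0 < k by rewrite /k; lra.
have ki0 : 0 < k^-1 by rewrite invr_gt0.
exists (C * ((s0 + 1) / k + 1 + k^-1) * (2 + k^-1)) => N s h /andP[s0s ss] h0.
have -> : C * ((s0 + 1) / k + 1 + k^-1) * (2 + k^-1) * h =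
  C * (h * ((s0 + 1) / k + 1 + k^-1)) * (2 + k^-1) by ring.
have D0 : 0 <= (s0 + 1) / k + 1 + k^-1.
  by rewrite !addr_ge0// ?mulr_ge0 ?ltW//; lra.
have E n : n.+1%:R `^ (- s) - n.+1%:R `^ (- (s + h)) =
    n.+1%:R `^ (- s) * (1 - n.+1%:R `^ (- h)) :> R.
  by rewrite opprD powR_natD mulrBr mulr1.
apply: (@abel_bound _ (fun n => n%:R `^ (- s) - n%:R `^ (- (s + h))) b k) => //=.
- by rewrite mulr_ge0.
- move=> n; rewrite E ger0_norm; last first.
    by rewrite mulr_ge0 ?powR_ge0// subr_ge0 powR_nat_le1//; lra.
  have /andP[_ d1] := onem_powR_le n h0 k0.
  apply: le_trans (ler_wpM2l (powR_ge0 _ _) d1) _.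
  rewrite mulrCA -powR_natD ler_pM ?powR_ge0 ?mulr_ge0 ?(ltW ki0)//.
    rewrite ler_wpM2l// lerDr addr_ge0// mulr_ge0 ?(ltW ki0)//; lra.
  by rewrite powR_nat_le//; rewrite /k; lra.
- move=> n; rewrite !E; set x := _ `^ (- s); set y := _ `^ (- s).
  set u := _ `^ (- h); set v := _ `^ (- h).
  (* Discrete product rule: [1 - u] and [u - v] each supply a factor [h]. *)
  have -> : x * (1 - u) - y * (1 - v) = (x - y) * (1 - u) - y * (u - v) by ring.
  apply: le_trans (ler_normB _ _) _; rewrite !normrM.
  have s1 : 0 <= s by lra.
  have /andP[d0 d1] := powR_nat_diff n s1.
  have /andP[e0 e1] := powR_nat_diff n h0.
  have /andP[g0 g1] := onem_powR_le n h0 k0.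
  rewrite (ger0_norm d0) (ger0_norm e0) (ger0_norm g0) (ger0_norm (powR_ge0 _ _)).
  have -> : h * ((s0 + 1) / k + 1 + k^-1) * n.+1%:R `^ (- b - (1 + k)) =
    (s0 + 1) * (h / k) * n.+1%:R `^ (- b - (1 + k)) +
    h * n.+1%:R `^ (- b - (1 + k)) + h / k * n.+1%:R `^ (- b - (1 + k)) by ring.
  rewrite -[leLHS]addr0; apply: lerD; last first.
    by rewrite mulr_ge0 ?powR_ge0// divr_ge0// ltW.
  apply: lerD.
    apply: le_trans (ler_pM d0 g0 d1 g1) _.
    rewrite mulrACA -powR_natD ler_pM ?powR_ge0 ?mulr_ge0 ?(ltW ki0)//.
      by rewrite ler_wpM2r ?mulr_ge0 ?(ltW ki0)//; lra.
    by rewrite powR_nat_le//; rewrite /k; lra.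
  have yx : y <= x by rewrite -subr_ge0.
  apply: le_trans (ler_pM (powR_ge0 _ _) e0 yx e1) _.
  rewrite mulrCA -powR_natD ler_wpM2l// powR_nat_le//; rewrite /k; lra.
Qed.

Lemma expR_le_1Dx (u : R) : u ^+ 2 <= 2^-1 -> expR (u - 2 * u ^+ 2) <= 1 + u.
Proof.
(* [1 + u = (1 - u^2) / (1 - u)] with [1 - u <= exp (-u)] and
   [1 - v >= exp (- v / (1 - v)) >= exp (- 2 v)] for [v := u^2 <= 1/2] *)
move=> u2; have u1 : 0 < 1 - u by nra.
have H1 : expR u * (1 - u) <= 1.
  have := expR_ge1Dx (- u) => H.
  by apply: le_trans (ler_wpM2l (expR_ge0 u) H) _; rewrite -expRD subrr expR0.
have H2 : expR (- (2 * u ^+ 2)) <= 1 - u ^+ 2.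
  rewrite expRN invf_ple ?posrE ?expR_gt0//; last by nra.
  apply: le_trans (expR_ge1Dx _).
  rewrite -[leLHS]div1r ler_pdivrMr; nra.
rewrite expRD -(ler_pM2r u1) mulrAC.
have -> : (1 + u) * (1 - u) = 1 - u ^+ 2 by ring.
apply: le_trans H2; rewrite ler_piMl// expR_ge0.
Qed.
End RealPowers.

(** * Squarefree smooth numbers *)

(** The test made by [mobius]. It holds at [0], since [primes 0] is empty; hence the conditions
    [0 < n] beside it. *)
Definition sqfree (n : nat) : bool :=
  all (fun p => logn p n == 1%N) (primes n).

(** The squarefree [y]-smooth numbers, built one prime at a time so that Euler products follow by
    induction on [y]. *)
Fixpoint smooth (y : nat) : seq nat :=
  if y is y'.+1 then
    if prime y then smooth y' ++ [seq (y * n)%N | n <- smooth y'] else smooth y'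
  else [:: 1%N].

Lemma primes_pM p n : prime p -> (0 < n)%N -> ~~ (p %| n)%N ->
  perm_eq (primes (p * n)) (p :: primes n).
Proof.
move=> pp n0 pn; apply: uniq_perm; rewrite ?primes_uniq//=.
  by rewrite primes_uniq mem_primes (negPf pn) !andbF.
by move=> q; rewrite inE primesM ?(prime_gt0 pp)// primes_prime// !inE.
Qed.

Lemma sqfree_pM p n : prime p -> (0 < n)%N -> ~~ (p %| n)%N ->
  sqfree (p * n) = sqfree n.
Proof.
move=> pp n0 pn; have p0 := prime_gt0 pp.
rewrite /sqfree (perm_all _ (primes_pM pp n0 pn))/= lognM// logn_prime// eqxx.
rewrite (_ : logn p n = 0%N) ?addn0/=; last first.
  by apply/eqP; rewrite -leqn0 leqNgt logn_gt0 mem_primes (negPf pn) !andbF.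
apply: eq_in_all => q; rewrite mem_primes => /and3P[qp _ qn].
rewrite lognM// logn_prime//; case: (q =P p) => // E.
by rewrite -E qn in pn.
Qed.

Lemma mem_smooth y n :
  (n \in smooth y) = [&& (0 < n)%N, sqfree n & all (fun p => (p <= y)%N) (primes n)].
Proof.
elim: y n => [|y IH] n /=.
  rewrite inE; apply/eqP/idP => [->//|/and3P[n0 _ /allP H]].
  case: (ltnP 1 n) => [n1|]; last by case: n n0 {H} => [|[|]].
  have := H (pdiv n); rewrite mem_primes pdiv_prime// n0 pdiv_dvd => /(_ isT).
  by rewrite leqn0 => /eqP H0; have := pdiv_prime n1; rewrite H0.
case: ifPn => pp; last first.
  rewrite IH; congr [&& _, _ & _]; apply: eq_in_all => q.
  rewrite mem_primes => /andP[qp _]; rewrite [RHS]leq_eqVlt ltnS.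
  by case: eqP => // E; rewrite -E qp in pp.
rewrite mem_cat IH; apply/orP/idP => [[/and3P[n0 sn /allP H]|/mapP[m]]|].
- by rewrite n0 sn; apply/allP => q /H /leqW.
- rewrite IH => /and3P[m0 sm /allP H] ->.
  have pm : ~~ (y.+1 %| m)%N.
    apply/negP => ym; have := H y.+1; rewrite mem_primes pp m0 ym => /(_ isT).
    by rewrite ltnn.
  rewrite muln_gt0/= m0 sqfree_pM// sm (perm_all _ (primes_pM pp m0 pm))/= leqnn/=.
  by apply/allP => q /H /leqW.
- move=> /and3P[n0 sn /allP H].
  case: (boolP (y.+1 %| n)%N) => [|yn]; last first.
    left; rewrite n0 sn; apply/allP => q qn; have := H _ qn.
    rewrite leq_eqVlt ltnS => /orP[/eqP E|//].
    by move: qn yn; rewrite mem_primes E => /and3P[_ _ ->].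
  move=> /dvdnP[m E]; right; rewrite mulnC in E; apply/mapP; exists m => //.
  have m0 : (0 < m)%N by move: n0; rewrite E muln_gt0 => /andP[].
  have ym : ~~ (y.+1 %| m)%N.
    have yn : y.+1 \in primes n by rewrite mem_primes pp n0 E dvdn_mulr.
    have := allP sn _ yn; rewrite {1}E lognM// logn_prime// eqxx add1n eqSS => /eqP L.
    apply/negP => ym; have : (0 < logn y.+1 m)%N by rewrite logn_gt0 mem_primes pp m0.
    by rewrite L.
  rewrite IH m0/= -(sqfree_pM pp m0 ym) -E sn/=.
  apply/allP => q qm.
  have : q \in primes n by rewrite E (perm_mem (primes_pM pp m0 ym)) inE qm orbT.
  move=> /H; rewrite leq_eqVlt ltnS => /orP[/eqP Eq|//].
  by move: qm ym; rewrite mem_primes Eq => /and3P[_ _ ->].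
Qed.

Lemma smooth_ndvd y n : n \in smooth y -> ~~ (y.+1 %| n)%N || ~~ prime y.+1.
Proof.
rewrite mem_smooth -negb_and => /and3P[n0 _ /allP H]; apply/negP => /andP[yn pp].
by have := H y.+1; rewrite mem_primes pp n0 yn ltnn => /(_ isT).
Qed.

Lemma smooth_uniq y : uniq (smooth y).
Proof.
elim: y => //= y IH; case: ifPn => // pp.
rewrite cat_uniq IH/= map_inj_uniq ?IH ?andbT; last first.
  by move=> a b /eqP; rewrite eqn_pmul2l// => /eqP.
apply/hasPn => _ /mapP[m _ ->]; apply/negP => /smooth_ndvd.
by rewrite dvdn_mulr// pp.
Qed.

(** Passing a prime [p = y.+1] adds to the old [n] their multiples [p * n], which multiplies the sum
    by [1 + g p]. *)
Lemma euler_product {V : comPzRingType} (g : nat -> V) y : g 1%N = 1 ->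
  (forall p n, prime p -> (0 < n)%N -> sqfree n -> ~~ (p %| n)%N ->
     g (p * n)%N = g p * g n) ->
  \sum_(n <- smooth y) g n = \prod_(1 <= p < y.+1 | prime p) (1 + g p).
Proof.
move=> g1 gM; elim: y => [|y IH]; first by rewrite /= big_seq1 big_geq.
rewrite [RHS]big_mkcond/= big_nat_recr//= -big_mkcond/= -IH.
case: ifPn => pp; last by rewrite mulr1.
rewrite big_cat/= big_map mulrDr mulr1; congr +%R.
rewrite mulr_suml big_seq [RHS]big_seq; apply: eq_bigr => n ny.
have := smooth_ndvd ny; rewrite pp orbF => yn.
by move: ny; rewrite mem_smooth => /and3P[n0 sn _]; rewrite gM// mulrC.
Qed.

(** Every positive [n <= N] is [N]-smooth, so ordinary partial sums become comparable with Euler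
    products. *)
Lemma big_nat_smooth {V : nmodType} (F : nat -> V) N :
  (forall n, (0 < n)%N -> ~~ sqfree n -> F n = 0) ->
  \sum_(1 <= n < N.+1) F n = \sum_(n <- smooth N | (n <= N)%N) F n.
Proof.
move=> F0; rewrite big_nat_cond.
rewrite (bigID sqfree)/= [X in _ + X]big1 ?addr0; last first.
  by move=> n /andP[/andP[/andP[n0 _] _]]; exact: F0.
rewrite -[LHS]big_filter -[RHS]big_filter; apply: perm_big; apply: uniq_perm.
- by rewrite filter_uniq// iota_uniq.
- by rewrite filter_uniq// smooth_uniq.
move=> n; rewrite !mem_filter mem_smooth mem_index_iota ltnS.
case: (posnP n) => [->|n0]; first by rewrite !andbF.
rewrite !andbT/=; case: (leqP n N) => nN; rewrite ?andbF//= andbT.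
rewrite -[LHS]andbT; congr andb; apply/esym/allP => p.
by rewrite mem_primes => /and3P[_ _ /dvdn_leq pn]; apply: leq_trans nN; apply: pn.
Qed.

(** * Dyadic chaining *)

Section DyadicMaximal.
Context {R : realType}.
Implicit Types a d : nat -> R.

Lemma sqr_sum_le d n :
  (\sum_(0 <= j < n) d j) ^+ 2 <= n%:R * \sum_(0 <= j < n) d j ^+ 2.
Proof.
elim: n => [|n IH]; first by rewrite !big_geq// expr0n mulr0.
rewrite !big_nat_recr//=; set D := \sum_(0 <= j < n) d j in IH *.
set S := \sum_(0 <= j < n) d j ^+ 2 in IH *.
have H : 2 * D * d n <= S + n%:R * d n ^+ 2.
  rewrite /D /S mulrAC mulr_sumr.
  have -> : n%:R * d n ^+ 2 = \sum_(0 <= j < n) d n ^+ 2.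
    by rewrite sumr_const_nat subn0 mulr_natl.
  rewrite -big_split/=; apply: ler_sum => j _.
  by have := sqr_ge0 (d j - d n); lra.
by rewrite -natr1; lra.
Qed.

Lemma sum_block a K j i : (i.+1 * 2 ^ j <= 2 ^ K)%N ->
  \sum_(0 <= n < 2 ^ K | (n %/ 2 ^ j)%N == i) a n =
  \sum_(i * 2 ^ j <= n < i.+1 * 2 ^ j) a n.
Proof.
move=> iK; have e0 : (0 < 2 ^ j)%N by rewrite expn_gt0.
rewrite (@big_cat_nat _ _ _ (i * 2 ^ j))//=; last first.
  by rewrite (leq_trans _ iK)// leq_mul2r leqnSn orbT.
rewrite [X in _ + X](@big_cat_nat _ _ _ (i.+1 * 2 ^ j))//=; last first.
  by rewrite leq_mul2r leqnSn orbT.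
rewrite big_nat_cond big1 ?add0r; last first.
  move=> n /andP[/andP[_ ni] /eqP E].
  by move: ni; rewrite ltnNge -leq_divRL// E leqnn.
rewrite [X in _ + X]big_nat_cond [X in _ + X]big1 ?addr0; last first.
  move=> n /andP[/andP[ni _] /eqP E].
  by move: ni; rewrite -leq_divRL// E ltnn.
rewrite big_nat_cond [RHS]big_nat_cond; apply: eq_bigl => n.
rewrite andbT; case: (boolP (_ <= n < _)%N) => //= /andP[n1 n2].
by rewrite eqn_leq -ltnS ltn_divLR// n2 leq_divRL.
Qed.

(** The binary digits of [N] cut [[0, N)] into at most one dyadic block per scale. Cauchy-Schwarz
    over the [K.+1] scales gives the factor, and each square is bounded by the sum over all blocks
    of its scale. *)
Lemma dyadic_maximal a K N : (N <= 2 ^ K)%N ->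
  (\sum_(0 <= n < N) a n) ^+ 2 <= K.+1%:R * \sum_(0 <= j < K.+1)
    \sum_(0 <= i < 2 ^ K) (\sum_(0 <= n < 2 ^ K | (n %/ 2 ^ j)%N == i) a n) ^+ 2.
Proof.
move=> NK; pose A m := \sum_(0 <= n < m) a n.
(* The block contributed by the [j]-th binary digit of [N]. *)
pose d j := A ((N %/ 2 ^ j) * 2 ^ j)%N - A ((N %/ 2 ^ j.+1) * 2 ^ j.+1)%N.
have -> : \sum_(0 <= n < N) a n = \sum_(0 <= j < K.+1) d j.
  rewrite -[RHS]opprK -sumrN; under [in RHS]eq_bigr do rewrite /d opprB.
  rewrite (telescope_sumr (fun j => A ((N %/ 2 ^ j) * 2 ^ j)%N))// expn0 divn1 muln1 divn_small; last first.
    by rewrite (leq_ltn_trans NK)// ltn_exp2l.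
  by rewrite mul0n opprB {2}/A [X in _ - X]big_geq// subr0.
apply: le_trans (sqr_sum_le _ _) _; rewrite ler_wpM2l//.
apply: ler_sum => j _; rewrite /d.
set q := (N %/ 2 ^ j)%N; have -> : (N %/ 2 ^ j.+1 = q./2)%N.
  by rewrite expnSr divnMA divn2.
have qN : (q * 2 ^ j <= 2 ^ K)%N by apply: leq_trans NK; exact: leq_trunc_div.
have S0 (F : nat -> R) l m : 0 <= \sum_(l <= i < m) F i ^+ 2.
  by apply: sumr_ge0 => i _; exact: sqr_ge0.
(* Digit [0] gives an empty block, digit [1] the block of even index [i = q - 1]. *)
have := odd_double_half q; rewrite -muln2 expnS mulnA; case: (odd q) => qE; last first.
  by rewrite /= in qE; rewrite -[X in A (X * _)%N]qE add0n subrr expr0n S0.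
set i := (q./2 * 2)%N in qE *; rewrite add1n in qE.
have iK : (i < 2 ^ K)%N.
  by rewrite qE (leq_trans _ qN)// leq_pmulr// expn_gt0.
rewrite (big_cat_nat _ (ltnW iK))//=.
rewrite (big_ltn iK) addrCA; apply: ler_wpDr; first by rewrite addr_ge0 ?S0.
rewrite sum_block qE//; rewrite le_eqVlt; apply/orP; left; apply/eqP.
congr (_ ^+ 2); rewrite /A -qE.
have ij : (i * 2 ^ j <= i.+1 * 2 ^ j)%N by rewrite leq_mul2r leqnSn orbT.
by rewrite (big_cat_nat _ ij)//= addrAC subrr add0r.
Qed.
End DyadicMaximal.

(** * Bounded random variables *)

Section BoundedVariables.
Context {d : measure_display} {T : measurableType d} {R : realType}.
Variable P : probability T R.
Implicit Types (X Y : T -> R).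

(** Boundedness implies integrability and, unlike it, passes to products. *)
Definition brv X : Prop :=
  measurable_fun setT X /\ exists C : R, forall w, `|X w| <= C.

Definition Ex X : R := \int[P]_w X w.

Lemma brv_integrable X : brv X -> P.-integrable setT (EFin \o X).
Proof.
move=> [mX [C XC]]; apply: measurable_bounded_integrable => //.
  by rewrite (le_lt_trans (probability_le1 P measurableT))// ltry.
exists C; split; first exact: num_real.
by move=> x Cx w _ /=; apply: le_trans (XC w) (ltW Cx).
Qed.

Lemma brv_cst (c : R) : brv (fun=> c).
Proof. by split; [exact: measurable_cst|exists `|c|]. Qed.

Lemma brvD X Y : brv X -> brv Y -> brv (fun w => X w + Y w).
Proof.
move=> [mX [C XC]] [mY [D YD]]; split; first exact: measurable_funD.
by exists (C + D) => w; apply: le_trans (ler_normD _ _) _; apply: lerD.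
Qed.

Lemma brvM X Y : brv X -> brv Y -> brv (fun w => X w * Y w).
Proof.
move=> [mX [C XC]] [mY [D YD]]; split; first exact: measurable_funM.
by exists (C * D) => w; rewrite normrM ler_pM.
Qed.

Lemma brvZ c X : brv X -> brv (fun w => c * X w).
Proof. by move=> bX; apply: brvM => //; exact: brv_cst. Qed.

Lemma brvB X Y : brv X -> brv Y -> brv (fun w => X w - Y w).
Proof.
move=> bX bY; apply: brvD => //.
by under eq_fun do rewrite -mulN1r; exact: brvZ.
Qed.

Lemma brvX2 X : brv X -> brv (fun w => X w ^+ 2).
Proof. by move=> bX; under eq_fun do rewrite expr2; exact: brvM. Qed.

Lemma brv_sum (I : Type) (s : seq I) (Q : pred I) (F : I -> T -> R) :
  (forall i, brv (F i)) -> brv (fun w => \sum_(i <- s | Q i) F i w).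
Proof.
move=> bF; elim: s => [|i s IH].
  by under eq_fun do rewrite big_nil; exact: brv_cst.
under eq_fun do rewrite big_cons.
by case: (Q i) => //; apply: brvD.
Qed.

Lemma brv_prod (I : eqType) (s : seq I) (F : I -> T -> R) :
  (forall i, i \in s -> brv (F i)) -> brv (fun w => \prod_(i <- s) F i w).
Proof.
elim: s => [|i s IH] bF.
  by under eq_fun do rewrite big_nil; exact: brv_cst.
under eq_fun do rewrite big_cons.
apply: brvM; first by apply: bF; rewrite inE eqxx.
by apply: IH => j js; apply: bF; rewrite inE js orbT.
Qed.

Lemma Ex_cst c : Ex (fun=> c) = c.
Proof. 
transitivity (c * fine (P setT)); first exact: Rintegral_cst.
by rewrite probability_setT mulr1.
 Qed.

Lemma ExD X Y : brv X -> brv Y -> Ex (fun w => X w + Y w) = Ex X + Ex Y.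
Proof. by move=> bX bY; rewrite /Ex RintegralD//; exact: brv_integrable. Qed.

Lemma ExZ c X : brv X -> Ex (fun w => c * X w) = c * Ex X.
Proof. by move=> bX; rewrite /Ex RintegralZl//; exact: brv_integrable. Qed.

Lemma ExB X Y : brv X -> brv Y -> Ex (fun w => X w - Y w) = Ex X - Ex Y.
Proof. by move=> bX bY; rewrite /Ex RintegralB//; exact: brv_integrable. Qed.

Lemma Ex_le X Y : brv X -> brv Y -> (forall w, X w <= Y w) -> Ex X <= Ex Y.
Proof. by move=> bX bY XY; apply: le_Rintegral => //; exact: brv_integrable. Qed.

Lemma Ex_sum (I : Type) (s : seq I) (Q : pred I) (F : I -> T -> R) :
  (forall i, brv (F i)) ->
  Ex (fun w => \sum_(i <- s | Q i) F i w) = \sum_(i <- s | Q i) Ex (F i).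
Proof.
move=> bF; elim: s => [|i s IH].
  by rewrite big_nil; under eq_fun do rewrite big_nil; exact: Ex_cst.
rewrite big_cons -IH; under eq_fun do rewrite big_cons.
by case: (Q i) => //; rewrite ExD//; exact: brv_sum.
Qed.

Lemma Ex_sqr_sum_le (I : Type) (s : seq I) (Q : pred I) (F : I -> T -> R) :
  (forall i, brv (F i)) ->
  Ex (fun w => (\sum_(i <- s | Q i) F i w) ^+ 2) <=
  \sum_(i <- s | Q i) \sum_(j <- s | Q j) `|Ex (fun w => F i w * F j w)|.
Proof.
move=> bF; have bFF i j : brv (fun w => F i w * F j w) by exact: brvM.
have -> : Ex (fun w => (\sum_(i <- s | Q i) F i w) ^+ 2) =
    \sum_(i <- s | Q i) \sum_(j <- s | Q j) Ex (fun w => F i w * F j w).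
  under eq_fun do rewrite expr2 big_distrlr/=.
  rewrite Ex_sum; last by move=> i; exact: brv_sum.
  by apply: eq_bigr => i _; rewrite Ex_sum.
by apply: ler_sum => i _; apply: ler_sum => j _; exact: ler_norm.
Qed.

(** The Borel-Cantelli step: the sum of all [X k] has expectation at most [C], hence is finite
    almost surely, and it dominates every term. *)
Lemma ae_bounded (X : nat -> T -> R) (C : R) :
  (forall k, brv (X k)) -> (forall k w, 0 <= X k w) ->
  (forall n, \sum_(0 <= k < n) Ex (X k) <= C) ->
  {ae P, forall w, exists K, forall k, X k w <= K}.
Proof.
move=> bX X0 XC.
have X0E k w : (0 <= (X k w)%:E)%E by rewrite lee_fin.
have mX k : measurable_fun setT (EFin \o X k).
  by apply/measurable_EFinP; case: (bX k).
have ExE k : (\int[P]_w (X k w)%:E = (Ex (X k))%:E)%E.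
  rewrite /Ex /Rintegral fineK//.
  by apply: integrable_fin_num => //; exact: brv_integrable.
have iF : P.-integrable setT (fun w => \sum_(0 <= k <oo) (X k w)%:E)%E.
  apply/integrableP; split.
    by apply: ge0_emeasurable_sum => // k _; exact: mX.
  under eq_integral do rewrite gee0_abs ?nneseries_ge0//.
  rewrite integral_nneseries//.
  rewrite (@le_lt_trans _ _ C%:E) ?ltry//.
  apply: lime_le; first by apply: is_cvg_nneseries => n _ _; rewrite integral_ge0.
  apply: nearW => n; rewrite (eq_bigr (fun k => (Ex (X k))%:E)) => [|k _]; last first.
    by rewrite ExE.
  by rewrite sumEFin lee_fin.
apply: filterS (integrable_ae measurableT iF) => w /(_ I) Fw.
exists (fine (\sum_(0 <= k <oo) (X k w)%:E)%E) => k.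
rewrite -lee_fin fineK//.
apply: le_trans (nneseries_lim_ge k.+1 _) => //.
by rewrite big_nat_recr//= leeDr// sume_ge0.
Qed.

Lemma geometric_sum_le (r : R) n : 0 <= r < 1 ->
  \sum_(0 <= k < n) r ^+ k <= (1 - r)^-1.
Proof.
move=> /andP[r0 r1]; have r10 : 0 < 1 - r by rewrite subr_gt0.
rewrite -[leRHS]div1r ler_pdivlMr// big_mkord mulrC -[_ * _]opprK -mulNr opprB.
by rewrite -subrX1 opprB gerBl exprn_ge0.
Qed.

(** Each of the [n.+1] powers in the geometric sum is at least [r ^ n]. *)
Lemma mulSn_geometric_le (r : R) n : 0 <= r < 1 -> n.+1%:R * r ^+ n <= (1 - r)^-1.
Proof.
move=> r01; apply: le_trans (geometric_sum_le n.+1 r01).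
rewrite mulr_natl -[n.+1 in leLHS]subn0 -sumr_const_nat !big_nat.
apply: ler_sum => k /andP[_ kn]; case/andP: r01 => r0 r1.
by rewrite ler_wiXn2l// ltW.
Qed.

(** Weighted by [2 ^ (- 2 k (g + e))], the chaining bound at scale [2 ^ k] has expectation at most
    [C (k + 1)^2 2 ^ (- 2 k e)]. This is summable, so [ae_bounded] controls all scales at once. *)
Lemma ae_maximal (a : nat -> T -> R) (g e C : R) :
  (forall n, brv (a n)) -> 0 <= g -> 0 < e -> 0 <= C ->
  (forall N, \sum_(0 <= m < N.+1) \sum_(0 <= n < N.+1) `|Ex (fun w => a m w * a n w)|
     <= C * N.+1%:R `^ (2 * g)) ->
  {ae P, forall w, exists2 K : R, 0 <= K &
    forall N, `|\sum_(0 <= n < N.+2) a n w| <= K * N.+1%:R `^ (g + e)}.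
Proof.
move=> ba g0 e0 C0 HC.
pose V k w := k.+1%:R * \sum_(0 <= j < k.+1) \sum_(0 <= i < 2 ^ k)
   (\sum_(0 <= n < 2 ^ k | (n %/ 2 ^ j)%N == i) a n w) ^+ 2.
have V0 k w : 0 <= V k w.
  rewrite mulr_ge0// sumr_ge0// => j _; rewrite sumr_ge0// => i _; exact: sqr_ge0.
pose b (k : nat) : R := (2 ^ k)%:R `^ (- (2 * (g + e))).
have b0 k : 0 <= b k by exact: powR_ge0.
have bB k j i : brv (fun w => (\sum_(0 <= n < 2 ^ k | (n %/ 2 ^ j)%N == i) a n w) ^+ 2).
  by apply: brvX2; exact: brv_sum.
have bV k : brv (V k).
  by apply: brvZ; apply: brv_sum => j; apply: brv_sum => i; exact: bB.
have EV k : Ex (V k) <= k.+1%:R ^+ 2 * (C * (2 ^ k)%:R `^ (2 * g)).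
  rewrite ExZ; last by apply: brv_sum => j; apply: brv_sum => i; exact: bB.
  rewrite expr2 -mulrA ler_wpM2l// Ex_sum; last first.
    by move=> j; apply: brv_sum => i; exact: bB.
  rewrite mulr_natl -[X in _ *+ X]subn0 -sumr_const_nat; apply: ler_sum => j _.
  rewrite Ex_sum//.
  have := HC (2 ^ k).-1; rewrite prednK ?expn_gt0//; apply: le_trans.
  (* A pair [(m, n)] shares a block of length [2 ^ j] for at most one [i], so the blocks together
     cost no more than the full double sum. *)
  apply: (@le_trans _ _ (\sum_(0 <= i < 2 ^ k) \sum_(0 <= m < 2 ^ k)
      \sum_(0 <= n < 2 ^ k) if ((m %/ 2 ^ j)%N == i) && ((n %/ 2 ^ j)%N == i)
         then `|Ex (fun w => a m w * a n w)| else 0)).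
    apply: ler_sum => i _; apply: le_trans (Ex_sqr_sum_le _ _ ba) _.
    rewrite big_mkcond/=; apply: ler_sum => m _; case: ifPn => mi /=.
      by rewrite big_mkcond.
    by rewrite big1.
  rewrite exchange_big/=; apply: ler_sum => m _.
  rewrite exchange_big/=; apply: ler_sum => n _.
  rewrite -big_mkcond/= big_const_seq iter_addr_0.
  set c := count _ _; suff c1 : (c <= 1)%N.
    by case: c c1 => [|[|//]] _; rewrite ?mulr0n ?mulr1n.
  apply: (@leq_trans (count_mem (m %/ 2 ^ j)%N (index_iota 0 (2 ^ k)))).
    by apply: sub_count => i /= /andP[/eqP-> _].
  by rewrite count_uniq_mem ?iota_uniq// leq_b1.
(* Chosen so that the weighted power of [2] is [r ^ (4 k)]: two factors [r ^ k] absorb [k.+1 ^ 2],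
   one is summed and one is dropped. *)
pose r : R := 2 `^ (- (e / 2)).
have r0 : 0 < r by exact: powR_gt0.
have r1 : r < 1.
  rewrite /r /powR pnatr_eq0/= expR_lt1 mulNr oppr_lt0.
  by rewrite mulr_gt0 ?divr_gt0// ln_gt0// ltr1n.
have r01 : 0 <= r < 1 by rewrite (ltW r0) r1.
have bE k : b k * (2 ^ k)%:R `^ (2 * g) = (r ^+ k) ^+ 4.
  have n2 : (2 ^ k)%:R != 0 :> R by rewrite pnatr_eq0 expn_eq0.
  rewrite /b -powRD ?n2 ?implybT// /r natrX.
  rewrite -!powR_mulrn ?powR_ge0// -!powRrM; congr (_ `^ _); by field.
have /ae_bounded H : forall n, \sum_(0 <= k < n) Ex (fun w => b k * V k w) <=
    C * (1 - r)^-1 ^+ 2 * (1 - r)^-1.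
  move=> n; apply: le_trans (ler_wpM2l _ (geometric_sum_le n r01)); last first.
    by rewrite mulr_ge0// sqr_ge0.
  rewrite mulr_sumr; apply: ler_sum => k _; rewrite ExZ//.
  apply: le_trans (ler_wpM2l (b0 k) (EV k)) _.
  rewrite mulrCA [b k * _]mulrCA bE.
  have -> : k.+1%:R ^+ 2 * (C * r ^+ k ^+ 4) =
    C * ((k.+1%:R * r ^+ k) ^+ 2) * r ^+ k * r ^+ k by ring.
  have rk0 : 0 <= r ^+ k by rewrite exprn_ge0// ltW.
  have rk1 : r ^+ k <= 1 by rewrite exprn_ile1// ltW.
  have m0 : 0 <= k.+1%:R * r ^+ k by rewrite mulr_ge0.
  apply: (@le_trans _ _ (C * (k.+1%:R * r ^+ k) ^+ 2 * r ^+ k)).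
    by rewrite ler_piMr// !mulr_ge0// sqr_ge0.
  rewrite ler_wpM2r// ler_wpM2l// lerXn2r ?nnegrE// ?mulSn_geometric_le//.
  by rewrite invr_ge0 subr_ge0 ltW.
apply: filterS (H _ _) => [w [K HK]|k|k w]; last 2 first.
- exact: brvZ.
- by rewrite mulr_ge0.
have K0 : 0 <= K by apply: le_trans (HK 0%N); rewrite mulr_ge0.
(* [K + 1] serves in place of a square root, as [K <= (K + 1) ^ 2]; the power of [2] pays for
   rounding [N.+2] up to a dyadic length. *)
exists ((K + 1) * 2 `^ (g + e)) => [|N].
  by rewrite mulr_ge0 ?powR_ge0// addr_ge0.
pose k := (trunc_log 2 N.+1).+1.
have Nk : (N.+2 <= 2 ^ k)%N by rewrite /k; exact: trunc_log_ltn.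
have kN : (2 ^ k <= 2 * N.+1)%N by rewrite /k expnS leq_mul2l/= trunc_logP.
have ge0 : 0 <= g + e by rewrite addr_ge0// ltW.
have := dyadic_maximal (fun n => a n w) Nk; rewrite -/(V k w) => HV.
pose Y : R := (2 ^ k)%:R `^ (g + e).
have Y0 : 0 < Y by rewrite powR_gt0// ltr0n expn_gt0.
have VY : V k w <= K * Y ^+ 2.
  have := HK k; rewrite /b powRN mulrC ler_pdivrMr; last first.
    by rewrite powR_gt0// ltr0n expn_gt0.
  by rewrite mulrC -[in X in _ <= X -> _]mulrC powRrM powRAC powR_mulrn ?powR_ge0.
apply: (@le_trans _ _ ((K + 1) * Y)).
  rewrite -ler_sqr ?nnegrE ?mulr_ge0 ?addr_ge0 ?(ltW Y0)//.
  rewrite real_normK ?num_real//; apply: le_trans HV _; apply: le_trans VY _.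
  rewrite exprMn ler_wpM2r ?sqr_ge0//; nra.
rewrite -mulrA ler_wpM2l ?addr_ge0// -powRM ?ler0n//.
by rewrite ge0_ler_powR ?nnegrE ?mulr_ge0 ?ler0n// -natrM ler_nat.
Qed.
End BoundedVariables.

(** * Correlations of a random multiplicative function *)

Section RandomMultiplicative.
Context {d : measure_display} {T : measurableType d} {R : realType}.
Variables (P : probability T R) (f : nat -> {RV P >-> R}).
Hypothesis f_rmf : random_multiplicative f.

(** Independence concerns events, so expectations of products pass through the indicators [I p] of
    [f p = 1], with [f p = 2 * I p - 1]. *)
Let B p : set T := f p @^-1` [set 1].
Let I p : T -> R := \1_(B p).
Local Notation E := (Ex P).

Let measurable_B p : measurable (B p).
Proof.
by rewrite -[B p]setTI; apply: (measurable_funPT (f p)) => //; exact: measurable_set1.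
Qed.

Let brv_I p : brv (I p).
Proof.
split; first exact: measurable_indic.
by exists 1 => w; rewrite /I indicE; case: (_ \in _); rewrite ?normr1 ?normr0.
Qed.

Lemma brv_rmf_prime p : prime p -> brv (f p).
Proof.
move=> pp; split; first exact: measurable_funPT.
by exists 1 => w; case: (rmf_pm1 f_rmf pp w) => ->; rewrite ?normrN normr1.
Qed.

Lemma sqr_rmf_prime p w : prime p -> f p w * f p w = 1.
Proof. by move=> pp; case: (rmf_pm1 f_rmf pp w) => ->; rewrite ?mulrNN mulr1. Qed.

Let f_indic p w : prime p -> f p w = 2 * I p w - 1.
Proof.
move=> pp; rewrite /I indicE; case: (rmf_pm1 f_rmf pp w) => fw.
  by rewrite mem_set//= fw; lra.
rewrite memNset/= ?fw; first by lra.
by rewrite /B/= fw; lra.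
Qed.

Let Ex_indic A : measurable A -> E \1_A = fine (P A).
Proof. by move=> mA; rewrite /Ex /Rintegral integral_indic// setIT. Qed.

Let Ex_prod_indic t : uniq t -> all prime t ->
  E (fun w => \prod_(p <- t) I p w) = \prod_(p <- t) E (I p).
Proof.
move=> ut pt; pose S := [fset p in t]%fset.
have mS p : (p \in S) = (p \in t) by rewrite /S inE.
have -> : (fun w => \prod_(p <- t) I p w) = \1_(\bigcap_(p in [set` S]) B p).
  apply/funext => w; rewrite indicE; case: (boolP (w \in _)).
    rewrite inE => H; rewrite big_seq big1// => p pS.
    by rewrite /I indicE mem_set//; apply: H; rewrite /= mS.
  move=> /negP; rewrite inE => H; apply/eqP; rewrite prodf_seq_eq0.
  apply: contrapT => /negP /hasPn H'; apply: H => p /=; rewrite mS => /H'.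
  by rewrite /= /I indicE; case: (boolP (w \in _)); rewrite ?inE ?eqxx.
rewrite Ex_indic; last first.
  by apply: fin_bigcap_measurable => // p _; exact: measurable_B.
have SP : [set` S] `<=` [set p | prime p] by move=> p /=; rewrite mS => /(allP pt).
have mA p : p \in S -> measurable [set 1 : R] by move=> _; exact: measurable_set1.
rewrite (rmf_indep f_rmf SP mA).
rewrite (eq_bigr (fun p => (E (I p))%:E)) => [|p _]; last first.
  by rewrite Ex_indic ?fineK ?fin_num_measure//; exact: measurable_B.
rewrite prodEFin/=; apply: perm_big; apply: uniq_perm => //; exact: fset_uniq.
Qed.

(** Induction on [s]: a factor [f p] becomes [2 * I p - 1] and moves to the indicator side, which is
    why the statement mixes both products. *)
Let Ex_prod_rmf_indic s t : uniq (s ++ t) -> all prime (s ++ t) ->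
  E (fun w => (\prod_(p <- s) f p w) * \prod_(p <- t) I p w) =
  (\prod_(p <- s) E (f p)) * \prod_(p <- t) E (I p).
Proof.
elim: s t => [|p s IH] t ust pst.
  rewrite big_nil mul1r -Ex_prod_indic//; congr Ex.
  by apply/funext => w; rewrite big_nil mul1r.
have pE : perm_eq (p :: s ++ t) (s ++ p :: t).
  by apply/permPl; exact: (perm_catCA [:: p] s t).
have ust' : uniq (s ++ p :: t) by rewrite -(perm_uniq pE).
have pst' : all prime (s ++ p :: t) by rewrite -(perm_all _ pE).
move: ust pst => /= /andP[_ ust] /andP[pp pst].
have bs : brv (fun w => \prod_(q <- s) f q w).
  apply: brv_prod => q qs; apply: brv_rmf_prime; apply: (allP pst).
  by rewrite mem_cat qs.
have bt u : brv (fun w => \prod_(q <- u) I q w) by apply: brv_prod => q _; exact: brv_I.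
have -> : (fun w => (\prod_(q <- p :: s) f q w) * \prod_(q <- t) I q w) =
  (fun w => 2 * ((\prod_(q <- s) f q w) * \prod_(q <- p :: t) I q w) -
            ((\prod_(q <- s) f q w) * \prod_(q <- t) I q w)).
  by apply/funext => w; rewrite !big_cons f_indic//; ring.
rewrite ExB ?ExZ ?IH ?big_cons//; do ?[apply: brvZ|apply: brvM] => //.
have -> : E (f p) = 2 * E (I p) - 1.
  rewrite -ExZ// -[X in _ - X](Ex_cst P) -ExB; [|exact: brvZ|exact: brv_cst].
  by congr Ex; apply/funext => w; exact: f_indic.
ring.
Qed.

Lemma Ex_prod_rmf s : uniq s -> all prime s ->
  E (fun w => \prod_(p <- s) f p w) = \prod_(p <- s) E (f p).
Proof.
move=> us ps; have := @Ex_prod_rmf_indic s [::]; rewrite cats0 big_nil mulr1.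
move=> <- //; congr Ex; apply/funext => w; by rewrite big_nil mulr1.
Qed.

(** Since [f p ^ 2 = 1], equal factors cancel in pairs; the primes of odd multiplicity remain. *)
Lemma rmf_prod_reduce u : all prime u -> exists s : seq nat,
  [/\ uniq s, {subset s <= u} &
      forall w, \prod_(p <- u) f p w = \prod_(p <- s) f p w].
Proof.
elim: u => [|p u IH] /= => [_|/andP[pp /IH[s [us su sE]]]]; first by exists [::].
case: (boolP (p \in s)) => ps.
  exists (rem p s); split; first exact: rem_uniq.
    by move=> q /mem_rem /su qu; rewrite inE qu orbT.
  move=> w; rewrite big_cons sE (perm_big _ (perm_to_rem ps))/= big_cons mulrA.
  by rewrite sqr_rmf_prime// mul1r.
exists (p :: s); split; first by rewrite /= ps us.
  by move=> q; rewrite !inE => /orP[->//|/su ->]; rewrite orbT.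
by move=> w; rewrite !big_cons sE.
Qed.

Lemma Ex_rmf_mul p u : prime p -> all prime u -> p \notin u ->
  E (fun w => f p w * \prod_(q <- u) f q w) =
  E (f p) * E (fun w => \prod_(q <- u) f q w).
Proof.
move=> pp pu pnu; have [s [us su sE]] := rmf_prod_reduce pu.
have ps : all prime s by apply/allP => q /su /(allP pu).
have -> : (fun w => \prod_(q <- u) f q w) = (fun w => \prod_(q <- s) f q w).
  by apply/funext.
have -> : (fun w => f p w * \prod_(q <- u) f q w) =
          (fun w => \prod_(q <- p :: s) f q w).
  by apply/funext => w; rewrite sE big_cons.
rewrite !Ex_prod_rmf ?big_cons//=; last by rewrite pp.
by rewrite us andbT; apply: contra pnu => /su.
Qed.

(* [rmf n] agrees with [f n] for [n > 0]; unlike [f 0], [rmf 0] is bounded. *)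
Definition rmf (n : nat) (w : T) : R :=
  if (0 < n)%N && sqfree n then \prod_(p <- primes n) f p w else 0.

Lemma rmfE n w : (0 < n)%N -> rmf n w = f n w.
Proof.
move=> n0; rewrite /rmf n0/=; case: (ltnP 1 n) => n1; last first.
  have -> : n = 1%N by apply/eqP; rewrite eqn_leq n1.
  by rewrite /= big_nil (rmf_one f_rmf).
rewrite (rmf_mul f_rmf)// /mobius -/(sqfree n); case: (sqfree n).
  by rewrite normrX normrN1 expr1n mul1r.
by rewrite normr0 mul0r.
Qed.

Lemma brv_rmf n : brv (rmf n).
Proof.
rewrite /rmf; case: (_ && _); last exact: brv_cst.
apply: brv_prod => p; rewrite mem_primes => /and3P[pp _ _]; exact: brv_rmf_prime.
Qed.

Lemma rmf0 n w : ~~ sqfree n -> rmf n w = 0.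
Proof. by move=> sn; rewrite /rmf (negPf sn) andbF. Qed.

Lemma rmf1 w : rmf 1 w = 1. Proof. by rewrite /rmf/= big_nil. Qed.

Lemma rmf_prime p w : prime p -> rmf p w = f p w.
Proof. by move=> pp; rewrite rmfE ?prime_gt0. Qed.

Lemma rmfM p n w : prime p -> (0 < n)%N -> sqfree n -> ~~ (p %| n)%N ->
  rmf (p * n) w = rmf p w * rmf n w.
Proof.
move=> pp n0 sn pn; rewrite (rmf_prime w pp) /rmf muln_gt0 prime_gt0// n0 sqfree_pM// sn/=.
by rewrite (perm_big _ (primes_pM pp n0 pn))/= big_cons.
Qed.

Definition corr (m n : nat) : R := `|E (fun w => rmf m w * rmf n w)|.

Lemma corrC m n : corr m n = corr n m.
Proof.
by rewrite /corr; congr `|_|; congr Ex; apply/funext => w; rewrite mulrC.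
Qed.

Section SmoothStep.
Variables (y m n : nat).
Hypotheses (pp : prime y.+1) (my : m \in smooth y) (ny : n \in smooth y).

Let dvd_y k : k \in smooth y -> [/\ (0 < k)%N, sqfree k & ~~ (y.+1 %| k)%N].
Proof.
move=> ky; have := smooth_ndvd ky; rewrite pp orbF => yk.
by move: ky; rewrite mem_smooth => /and3P[].
Qed.

(** The new prime occurs once, so independence splits off its mean. *)
Lemma corrMl : corr (y.+1 * m) n = `|E (f y.+1)| * corr m n.
Proof.
have [m0 sm ym] := dvd_y my; have [n0 sn yn] := dvd_y ny.
rewrite /corr -normrM; congr `|_|.
have rmn w : rmf m w * rmf n w = \prod_(q <- primes m ++ primes n) f q w.
  by rewrite big_cat/= /rmf m0 n0 sm sn.
have -> : (fun w => rmf m w * rmf n w) =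
  (fun w => \prod_(q <- primes m ++ primes n) f q w) by apply/funext.
rewrite -Ex_rmf_mul//.
- congr Ex; apply/funext => w; rewrite rmfM// (rmf_prime w pp) -mulrA rmn//.
- by apply/allP => q; rewrite mem_cat !mem_primes => /orP[] /andP[].
- by rewrite mem_cat !mem_primes (negPf ym) (negPf yn) !andbF.
Qed.

(** The new prime occurs twice, and its square is [1]. *)
Lemma corrMM : corr (y.+1 * m) (y.+1 * n) = corr m n.
Proof.
have [m0 sm ym] := dvd_y my; have [n0 sn yn] := dvd_y ny.
rewrite /corr; congr `|_|; congr Ex; apply/funext => w.
by rewrite !rmfM// !(rmf_prime w pp) mulrACA sqr_rmf_prime// mul1r.
Qed.
End SmoothStep.

(** * Second moment over smooth numbers *)

Variables (alpha : R).
Hypotheses (alpha_bnd : 0 < alpha < 2^-1)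
  (mean_bnd : forall p, prime p -> `|E (f p)| <= p%:R `^ (- alpha)).

Definition moment (s : R) (y : nat) : R := \sum_(m <- smooth y)
  \sum_(n <- smooth y) corr m n * (m%:R `^ (- s) * n%:R `^ (- s)).

(** The three terms of the factor correspond to the new prime dividing neither, exactly one, or both
    of [m] and [n]. *)
Lemma momentS s y : prime y.+1 -> moment s y.+1 = moment s y *
  (1 + 2 * `|E (f y.+1)| * y.+1%:R `^ (- s) + y.+1%:R `^ (- s) ^+ 2).
Proof.
move=> pp; rewrite /moment /= pp !big_cat/= !big_map.
pose q : R := y.+1%:R `^ (- s).
pose F m n := corr m n * (m%:R `^ (- s) * n%:R `^ (- s)).
have qM n : (y.+1 * n)%:R `^ (- s) = q * n%:R `^ (- s).
  by rewrite natrM powRM ?ler0n.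
rewrite -/q -/(F _ _); set S := smooth y.
have E2 : \sum_(m <- S) \sum_(n <- S ++ [seq (y.+1 * n)%N | n <- S]) F m n =
    (\sum_(m <- S) \sum_(n <- S) F m n) * (1 + `|E (f y.+1)| * q).
  rewrite mulr_suml big_seq [RHS]big_seq; apply: eq_bigr => m mS.
  rewrite mulr_suml big_cat/= big_map -big_split/= big_seq [RHS]big_seq.
  apply: eq_bigr => n nS; rewrite /F [corr m (_ * _)]corrC corrMl// qM corrC; ring.
have E3 : \sum_(m <- S) \sum_(n <- S ++ [seq (y.+1 * n)%N | n <- S]) F (y.+1 * m)%N n =
    (\sum_(m <- S) \sum_(n <- S) F m n) * (`|E (f y.+1)| * q + q ^+ 2).
  rewrite mulr_suml big_seq [RHS]big_seq; apply: eq_bigr => m mS.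
  rewrite mulr_suml big_cat/= big_map -big_split/= big_seq [RHS]big_seq.
  by apply: eq_bigr => n nS; rewrite /F corrMM// corrMl// !qM; ring.
by rewrite E2 E3 -mulrDr; congr (_ * _); ring.
Qed.

Lemma moment_ge0 s y : 0 <= moment s y.
Proof.
rewrite sumr_ge0// => m _; rewrite sumr_ge0// => n _.
by rewrite mulr_ge0 ?mulr_ge0 ?powR_ge0// normr_ge0.
Qed.

Lemma moment_bound s : 1 - alpha < s -> exists2 C : R, 0 <= C &
  forall y, moment s y <= C.
Proof.
move=> als; have /andP[a0 a1] := alpha_bnd.
(* By the mean bound the Euler factor at [p] is at most [1 + g p]; the sum of [g] over all integers
   converges because [alpha + s > 1] and [2 * s > 1]. *)
pose g n : R := 2 * n%:R `^ (- (alpha + s)) + n%:R `^ (- (2 * s)).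
have g0 n : 0 <= g n by rewrite addr_ge0 ?mulr_ge0 ?powR_ge0.
exists (expR (2 * (1 + (alpha + s - 1)^-1) + (1 + (2 * s - 1)^-1))).
  exact: expR_ge0.
suff H y : moment s y <= expR (\sum_(1 <= n < y.+1) g n).
  move=> y; apply: le_trans (H y) _; rewrite ler_expR /g big_split/= -mulr_sumr.
  by apply: lerD; rewrite ?ler_wpM2l// zeta_bound//; lra.
elim: y => [|y IH].
  rewrite /moment/= !big_seq1 big_geq// expR0 !powR1 !mulr1 /corr.
  rewrite (_ : (fun w => _) = fun=> 1) ?Ex_cst ?normr1//.
  by apply/funext => w; rewrite !rmf1 mulr1.
rewrite big_nat_recr//= expRD; case: (boolP (prime y.+1)) => pp; last first.
  rewrite /moment/= (negPf pp) -/(moment s y) -[leLHS]mulr1.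
  by rewrite ler_pM ?moment_ge0// -expR0 ler_expR.
have q0 : 0 <= y.+1%:R `^ (- s) :> R by exact: powR_ge0.
rewrite momentS//; apply: ler_pM; rewrite ?moment_ge0//.
apply: le_trans (expR_ge1Dx _); rewrite -addrA lerD2l /g; apply: lerD.
  rewrite opprD powR_natD -mulrA ler_wpM2l// ler_wpM2r//; exact: mean_bnd.
by rewrite -powR_mulrn// -powRrM mulNr mulrC.
Qed.

(** Rankin's trick: for positive [m, n <= N] the weight [(m n) ^ (- s)] times [N.+1 ^ (2 s)] is at
    least [1], so the second moment dominates. *)
Lemma corr_sum_bound s : 1 - alpha < s -> exists2 C : R, 0 <= C &
  forall N, \sum_(0 <= m < N.+1) \sum_(0 <= n < N.+1) corr m n
     <= C * N.+1%:R `^ (2 * s).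
Proof.
move=> als; have /andP[a0 a1] := alpha_bnd.
have [C C0 HC] := moment_bound als; exists C => // N.
have c0l n : corr 0 n = 0.
  rewrite /corr (_ : (fun w => _) = fun=> 0) ?Ex_cst ?normr0//.
  by apply/funext => w; rewrite /rmf/= mul0r.
have cs m n : ~~ sqfree m -> corr m n = 0.
  move=> sm; rewrite /corr (_ : (fun w => _) = fun=> 0) ?Ex_cst ?normr0//.
  by apply/funext => w; rewrite rmf0// mul0r.
rewrite big_ltn// big1 ?add0r; last by move=> n _; rewrite c0l.
rewrite big_nat_smooth => [|m _ sm]; last by rewrite big1// => n _; rewrite cs.
apply: le_trans (ler_wpM2r (powR_ge0 _ _) (HC N)).
rewrite /moment mulr_suml big_mkcond/=; apply: ler_sum => m _.
have t0 k l : 0 <= corr k l * (k%:R `^ (- s) * l%:R `^ (- s)).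
  by rewrite mulr_ge0 ?mulr_ge0 ?powR_ge0// normr_ge0.
case: ifPn => mN; last by rewrite mulr_ge0 ?powR_ge0 ?sumr_ge0.
rewrite big_ltn// corrC c0l add0r big_nat_smooth => [|n _ sn]; last by rewrite corrC cs.
rewrite mulr_suml big_mkcond/=; apply: ler_sum => n _.
case: ifPn => nN; last by rewrite mulr_ge0 ?powR_ge0.
(* The case [k = 0] is set apart: a nonzero power of [0] is [0], and the correlation vanishes
   there. *)
have HN k : (k <= N)%N -> k = 0%N \/ 1 <= k%:R `^ (- s) * N.+1%:R `^ s.
  case: k => [|k] kN; [by left|right].
  rewrite powRN mulrC ler_pdivlMr ?powR_nat_gt0// mul1r.
  by rewrite ge0_ler_powR ?nnegrE ?ler0n ?ler_nat ?leqW//; lra.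
have [->|Hm] := HN _ mN; first by rewrite c0l !mul0r.
have [->|Hn] := HN _ nN; first by rewrite corrC c0l !mul0r.
rewrite -mulrA -[leLHS]mulr1 ler_wpM2l ?normr_ge0//.
have -> : 2 * s = s + s by ring.
by rewrite powR_natD mulrACA -[leLHS]mulr1 ler_pM.
Qed.
End RandomMultiplicative.

(** * Euler products *)

Section EulerApproximation.
Context {d : measure_display} {T : measurableType d} {R : realType}.
Variables (P : probability T R) (f : nat -> {RV P >-> R}).
Hypothesis f_rmf : random_multiplicative f.
Variables (alpha : R).
Hypotheses (alpha_bnd : 0 < alpha < 2^-1)
  (mean_bnd : forall p, prime p -> `|Ex P (f p)| <= p%:R `^ (- alpha)).

Lemma rmf_euler_product s y w :
  \sum_(n <- smooth y) rmf f n w * n%:R `^ (- s) =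
  \prod_(1 <= p < y.+1 | prime p) (1 + f p w * p%:R `^ (- s)).
Proof.
rewrite euler_product.
- by apply: eq_bigr => p pp; rewrite rmf_prime.
- by rewrite rmf1 powR1 mulr1.
- by move=> p n pp n0 sn pn; rewrite rmfM// natrM powRM ?ler0n// mulrACA.
Qed.

Lemma euler_product_sub s y w :
  \prod_(1 <= p < y.+1 | prime p) (1 + f p w * p%:R `^ (- s)) -
  \sum_(1 <= n < y.+1) rmf f n w * n%:R `^ (- s) =
  \sum_(n <- smooth y | (y < n)%N) rmf f n w * n%:R `^ (- s).
Proof.
rewrite -rmf_euler_product big_nat_smooth; last first.
  by move=> n n0 sn; rewrite rmf0// mul0r.
rewrite (bigID (fun n => (n <= y)%N))/= addrAC subrr add0r.
by apply: eq_bigl => n; rewrite ltnNge.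
Qed.

(* Rankin's trick: [n ^ (- s) <= y ^ (- k) * n ^ (- (s - k))] for [n > y] *)
Lemma Ex_sqr_tail_le s k y : (0 < y)%N -> 0 <= k ->
  Ex P (fun w => (\sum_(n <- smooth y | (y < n)%N) rmf f n w * n%:R `^ (- s)) ^+ 2)
  <= y%:R `^ (- k) ^+ 2 * moment f (s - k) y.
Proof.
move=> y0 k0.
have bF n : brv (fun w => rmf f n w * n%:R `^ (- s)).
  by apply: brvM; [exact: brv_rmf|exact: brv_cst].
apply: le_trans (Ex_sqr_sum_le P _ _ bF) _.
have t0 m n t : 0 <= corr f m n * (m%:R `^ (- t) * n%:R `^ (- t)).
  by rewrite mulr_ge0 ?mulr_ge0 ?powR_ge0// normr_ge0.
have Hp n : (y < n)%N -> n%:R `^ (- s) <= y%:R `^ (- k) * n%:R `^ (- (s - k)) :> R.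
  case: n => // n yn; rewrite opprB [k - s]addrC powR_natD mulrCA ler_peMr ?powR_ge0//.
  rewrite powRN mulrC ler_pdivlMr ?powR_gt0 ?ltr0n// mul1r.
  by rewrite ge0_ler_powR ?nnegrE ?ler0n// ler_nat ltnW.
rewrite /moment mulr_sumr big_mkcond/=; apply: ler_sum => m _; rewrite mulr_sumr.
case: ifPn => my; last by rewrite sumr_ge0// => n _; rewrite mulr_ge0 ?sqr_ge0.
rewrite big_mkcond/=; apply: ler_sum => n _.
case: ifPn => ny; last by rewrite mulr_ge0 ?sqr_ge0.
have -> : `|Ex P (fun w => rmf f m w * m%:R `^ (- s) * (rmf f n w * n%:R `^ (- s)))|
    = corr f m n * (m%:R `^ (- s) * n%:R `^ (- s)).
  rewrite /corr -[X in _ = _ * X]ger0_norm ?mulr_ge0 ?powR_ge0// -normrM.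
  have bmn : brv (fun w => rmf f m w * rmf f n w) by apply: brvM; exact: brv_rmf.
  rewrite mulrC -(ExZ P _ bmn); congr `|_|; congr Ex.
  by apply/funext => w; rewrite mulrACA mulrC.
rewrite [leRHS]mulrCA ler_wpM2l ?normr_ge0// expr2 mulrACA.
by rewrite ler_pM ?powR_ge0// Hp.
Qed.

Lemma euler_approximation s : 1 - alpha < s ->
  {ae P, forall w, forall e : R, 0 < e -> exists j0, forall j, (j0 <= j)%N ->
   `|\prod_(1 <= p < (2 ^ j).+1 | prime p) (1 + f p w * p%:R `^ (- s)) -
     \sum_(1 <= n < (2 ^ j).+1) rmf f n w * n%:R `^ (- s)| <= e}.
Proof.
(* Half of the excess of [s] over [1 - alpha] goes to Rankin's trick, and the moment at [s - k]
   stays bounded. *)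
move=> als; pose k := (s - (1 - alpha)) / 2.
have k0 : 0 < k by rewrite divr_gt0// subr_gt0.
have sk : 1 - alpha < s - k by rewrite /k; lra.
have [C C0 HC] := moment_bound f_rmf alpha_bnd mean_bnd sk.
pose r : R := 2 `^ (- k).
have r0 : 0 < r by exact: powR_gt0.
have r1 : r < 1.
  rewrite /r /powR pnatr_eq0/= expR_lt1 mulNr oppr_lt0.
  by rewrite mulr_gt0// ln_gt0// ltr1n.
have r01 : 0 <= r < 1 by rewrite (ltW r0) r1.
have rE j : (2 ^ j)%:R `^ (- k) = r ^+ j.
  by rewrite /r natrX -!powR_mulrn ?powR_ge0// -!powRrM mulrC.
pose D j w := \sum_(n <- smooth (2 ^ j) | (2 ^ j < n)%N) rmf f n w * n%:R `^ (- s).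
have bD j : brv (D j).
  by apply: brv_sum => n; apply: brvM; [exact: brv_rmf|exact: brv_cst].
(* The second moment of [D j] is at most [C * r ^ (2 j)]. Dividing by [r ^ j] leaves a geometric
   series and still forces [D j] to tend to [0]. *)
have /ae_bounded H : forall n, \sum_(0 <= j < n) Ex P (fun w => (r ^+ j)^-1 * D j w ^+ 2)
    <= C * (1 - r)^-1.
  move=> n; apply: le_trans (ler_wpM2l C0 (geometric_sum_le n r01)).
  rewrite mulr_sumr; apply: ler_sum => j _; rewrite ExZ; last exact: brvX2.
  rewrite mulrC ler_pdivrMr ?exprn_gt0// -mulrA -expr2 mulrC.
  apply: le_trans (Ex_sqr_tail_le s _ (ltW k0)) _; first by rewrite expn_gt0.
  by rewrite rE ler_wpM2l ?sqr_ge0.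
apply: filterS (H _ _) => [w [K HK] e e0|j|j w]; last 2 first.
- by apply: brvZ; exact: brvX2.
- by rewrite mulr_ge0 ?sqr_ge0// invr_ge0 exprn_ge0// ltW.
have K0 : 0 <= K.
  by apply: le_trans (HK 0%N); rewrite expr0 invr1 mul1r sqr_ge0.
pose B := (1 - r)^-1.
have B0 : 0 <= B by rewrite invr_ge0 subr_ge0 ltW.
(* As [r ^ j <= B / j.+1], the bound [K * r ^ j] on [D j ^ 2] falls below [e ^ 2] once
   [j.+1 >= K * B / e ^ 2]. *)
exists (Num.truncn (K * B / e ^+ 2)).+1 => j jj.
rewrite euler_product_sub -/(D j w) -ler_sqr ?nnegrE ?(ltW e0)//.
rewrite real_normK ?num_real//.
have : D j w ^+ 2 <= K * r ^+ j.
  by have := HK j; rewrite mulrC ler_pdivrMr ?exprn_gt0.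
move=> /le_trans; apply.
have := mulSn_geometric_le j r01; rewrite -/B mulrC -ler_pdivlMr// => rj.
apply: le_trans (ler_wpM2l K0 rj) _.
rewrite mulrA ler_pdivrMr// [leRHS]mulrC -ler_pdivrMr ?exprn_gt0//.
apply: ltW; apply: lt_le_trans (truncnS_gt _) _.
by rewrite ler_nat ltnW.
Qed.
End EulerApproximation.

(** * Products and sums over primes *)

Section PrimeProducts.
Context {R : realType}.

Lemma prod_prime_le_expR (u : nat -> R) y :
  (forall p, prime p -> -1 <= u p) ->
  \prod_(1 <= p < y | prime p) (1 + u p) <=
  expR (\sum_(1 <= p < y | prime p) u p).
Proof.
move=> u1; rewrite expR_sum; apply: ler_prod => p pp.
by rewrite expR_ge1Dx andbT -lerBlDl sub0r u1.
Qed.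

Lemma expR_le_prod_prime (u : nat -> R) y :
  (forall p, prime p -> u p ^+ 2 <= 2^-1) ->
  expR (\sum_(1 <= p < y | prime p) (u p - 2 * u p ^+ 2)) <=
  \prod_(1 <= p < y | prime p) (1 + u p).
Proof.
move=> u1; rewrite expR_sum; apply: ler_prod => p pp.
by rewrite expR_ge0/= expR_le_1Dx// u1.
Qed.

Lemma sum_prime_le (u : nat -> R) y : (forall n, 0 <= u n) ->
  \sum_(1 <= p < y | prime p) u p <= \sum_(1 <= n < y) u n.
Proof.
by move=> u0; rewrite big_mkcond/=; apply: ler_sum => n _; case: ifPn.
Qed.

Lemma smooth_zeta_bound (s : R) y : 1 < s ->
  \sum_(n <- smooth y) n%:R `^ (- s) <= 1 + (s - 1)^-1.
Proof.
move=> s1; pose M := (\max_(n <- smooth y) n).+1.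
apply: le_trans (zeta_bound M s1).
have -> : \sum_(n <- smooth y) n%:R `^ (- s) =
    \sum_(1 <= n < M | n \in smooth y) n%:R `^ (- s).
  rewrite -[RHS]big_filter; apply: perm_big; apply: uniq_perm.
  - exact: smooth_uniq.
  - by rewrite filter_uniq// iota_uniq.
  move=> n; rewrite mem_filter mem_index_iota; case: (boolP (n \in _)) => //= ny.
  by rewrite /M ltnS leq_bigmax_seq// andbT; move: ny; rewrite mem_smooth => /andP[->].
by rewrite big_mkcond/=; apply: ler_sum => n _; case: ifPn => // _; exact: powR_ge0.
Qed.

Lemma prime_ge2R p : prime p -> (2 : R) <= p%:R.
Proof. by move=> pp; rewrite ler_nat prime_gt1. Qed.

Lemma prime_powR_half p (s : R) : prime p -> 2^-1 <= s ->
  p%:R `^ (- s) ^+ 2 <= 2^-1 :> R.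
Proof.
move=> pp s2; rewrite -powR_mulrn ?powR_ge0// -powRrM mulNr powRN.
rewrite lef_pV2 ?posrE ?powR_gt0 ?ltr0n ?prime_gt0//.
apply: le_trans (prime_ge2R pp) _; apply: le1r_powR; last by lra.
by apply: le_trans (prime_ge2R pp); rewrite ler1n.
Qed.

(** The Euler product of [1 + p ^ (- (1 + eta))] is bounded by a zeta sum, at most [1 + eta^-1].
    Taking logarithms costs twice the sum of squares, itself at most [2]; hence the [4]. *)
Lemma sum_prime_powR_le (eta : R) y : 0 < eta ->
  \sum_(1 <= p < y.+1 | prime p) p%:R `^ (- (1 + eta)) <= ln (1 + eta^-1) + 4.
Proof.
move=> eta0; have e1 : 0 < 1 + eta^-1 by rewrite addr_gt0// invr_gt0.
pose u p : R := p%:R `^ (- (1 + eta)).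
have Z : \prod_(1 <= p < y.+1 | prime p) (1 + u p) <= 1 + eta^-1.
  rewrite -(euler_product (g := u)).
  - have s1 : 1 < 1 + eta by lra.
    by have := smooth_zeta_bound y s1; rewrite [1 + eta - 1]addrC addKr.
  - by rewrite /u powR1.
  - by move=> p n pp _ _ _; rewrite /u natrM powRM ?ler0n.
have Hu p : prime p -> u p ^+ 2 <= 2^-1.
  by move=> pp; apply: prime_powR_half => //; lra.
have := le_trans (expR_le_prod_prime y.+1 Hu) Z.
rewrite -ler_ln ?posrE ?expR_gt0// expRK big_split/= sumrN -mulr_sumr.
have : \sum_(1 <= p < y.+1 | prime p) u p ^+ 2 <= 2.
  apply: le_trans (sum_prime_le _ _) _; first by move=> n; exact: sqr_ge0.
  have z2 : (1 : R) < 2 by rewrite ltr1n.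
  have -> : 2 = 1 + (2 - 1)^-1 :> R by rewrite [2 - 1]addrK// invr1.
  apply: le_trans (zeta_bound y.+1 z2); rewrite !big_nat.
  apply: ler_sum => -[//|n] _; rewrite /u -powR_mulrn ?powR_ge0// -powRrM.
  by apply: powR_nat_le; lra.
rewrite /u; lra.
Qed.
End PrimeProducts.

(** * The contradiction at one sample point: [v] is [f] on primes, [T] the truncated Dirichlet
    series *)

Section Contradiction.
Context {R : realType}.
Variables (alpha : R) (delta v : nat -> R) (T : nat -> R -> R).
Hypotheses (alpha_bnd : 0 < alpha < 2^-1)
  (delta_bnd : forall p, prime p -> 0 <= delta p <= 1)
  (v_sqr : forall p, prime p -> v p ^+ 2 = 1).
Variable K : R.
Hypothesis centered_bnd : forall N s, 1 - alpha <= s <= 1 - alpha + 1 ->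
  `|\sum_(1 <= n < N)
     (if prime n then v n + delta n * n%:R `^ (- alpha) else 0) * n%:R `^ (- s)| <= K.
Variables (c : R) (p0 : nat).
Hypotheses (c_bnd : 0 <= c < 1)
  (delta_le : forall p, prime p -> (p0 <= p)%N -> delta p <= c)
  (delta_div : forall M : R, exists y,
     M <= \sum_(1 <= p < y | prime p) delta p / p%:R).
Let prod_ y (s : R) := \prod_(1 <= p < y.+1 | prime p) (1 + v p * p%:R `^ (- s)).
Hypothesis approx : forall (k : nat) (e : R), 0 < e ->
  exists j0, forall j, (j0 <= j)%N ->
    `|prod_ (2 ^ j) (1 - alpha + k.+1%:R^-1) - T (2 ^ j) (1 - alpha + k.+1%:R^-1)| <= e.

(** At [s = 1 - alpha + eta] the exponents [alpha] and [s] add up to [1 + eta], so both sums combine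
    into the centered series. *)
Let sum_v y (eta : R) : 0 <= eta <= 1 ->
  `|\sum_(1 <= p < y | prime p) v p * p%:R `^ (- (1 - alpha + eta)) +
    \sum_(1 <= p < y | prime p) delta p * p%:R `^ (- (1 + eta))| <= K.
Proof.
move=> /andP[eta0 eta1]; set s := 1 - alpha + eta; rewrite -big_split/=.
have sb : 1 - alpha <= s <= 1 - alpha + 1 by apply/andP; split; rewrite /s; lra.
apply: le_trans (centered_bnd y sb); rewrite le_eqVlt; apply/orP; left.
apply/eqP; congr `|_|; rewrite big_mkcond/= !big_nat; apply: eq_bigr => n /andP[n0 _].
case: ifPn => pn; last by rewrite mul0r.
case: n n0 {pn} => // n _; rewrite mulrDl -mulrA -powR_natD; congr (_ + _ * _ `^ _).
by rewrite /s; ring.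
Qed.

Let half_alpha : 2^-1 <= 1 - alpha.
Proof. by have /andP[? ?] := alpha_bnd; lra. Qed.

Let prod_upper y (eta : R) : 0 <= eta <= 1 ->
  prod_ y (1 - alpha + eta) <=
  expR (K - \sum_(1 <= p < y.+1 | prime p) delta p * p%:R `^ (- (1 + eta))).
Proof.
move=> eta01; have := sum_v y.+1 eta01; rewrite ler_norml => /andP[_ H].
apply: le_trans (prod_prime_le_expR _ _) _; last by rewrite ler_expR; lra.
move=> p pp; have /andP[e0 _] := eta01.
have s2 : 2^-1 <= 1 - alpha + eta by have := half_alpha; lra.
have := prime_powR_half pp s2; have := v_sqr pp; nra.
Qed.

(** [K] bounds the centered series, the second term twice the sum of squares, [p0%:R] the primes
    below [p0], and [4] covers the constant of [sum_prime_powR_le] times [c < 1]. *)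
Let lower_cst : R :=
  K + 2 * (1 + (2 * (1 - alpha) - 1)^-1) + p0%:R + 4.

(** From [p0] on [delta p <= c], so the negative drift is at most [c * ln (1 + eta^-1)] up to a
    constant. *)
Let prod_lower y (eta : R) : 0 < eta <= 1 ->
  expR (- lower_cst - c * ln (1 + eta^-1)) <= prod_ y (1 - alpha + eta).
Proof.
move=> /andP[eta0 eta1]; have /andP[a0 a1] := alpha_bnd; have /andP[c0 c1] := c_bnd.
have eta01 : 0 <= eta <= 1 by rewrite ltW.
have s2 : 2^-1 <= 1 - alpha + eta by have := half_alpha; lra.
set s := 1 - alpha + eta in s2 *.
have Hu p : prime p -> (v p * p%:R `^ (- s)) ^+ 2 <= 2^-1.
  by move=> pp; rewrite exprMn v_sqr// mul1r prime_powR_half.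
apply: le_trans (expR_le_prod_prime y.+1 Hu); rewrite ler_expR.
rewrite big_split/= sumrN -mulr_sumr.
have := sum_v y.+1 eta01; rewrite -/s ler_norml => /andP[H _].
have H2 : \sum_(1 <= p < y.+1 | prime p) (v p * p%:R `^ (- s)) ^+ 2 <=
    1 + (2 * (1 - alpha) - 1)^-1.
  have z1 : 1 < 2 * (1 - alpha) by lra.
  apply: le_trans (zeta_bound y.+1 z1); rewrite big_mkcond/= !big_nat.
  apply: ler_sum => -[//|n] _; case: ifPn => pn; last exact: powR_ge0.
  rewrite exprMn v_sqr// mul1r -powR_mulrn ?powR_ge0// -powRrM powR_nat_le//.
  by rewrite /s; lra.
have H3 : \sum_(1 <= p < y.+1 | prime p) delta p * p%:R `^ (- (1 + eta)) <=
    p0%:R + c * (ln (1 + eta^-1) + 4).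
  have := ler_wpM2l c0 (sum_prime_powR_le y eta0); rewrite mulr_sumr => Hc.
  apply: le_trans (lerD (lexx _) Hc).
  have -> : p0%:R = \sum_(0 <= p < p0) (1 : R) by rewrite sumr_const_nat subn0.
  have sp0 : \sum_(1 <= p < y.+1 | prime p) (if (p < p0)%N then 1 else 0) <=
      \sum_(0 <= p < p0) (1 : R).
    apply: le_trans (sum_prime_le _ _) _; first by move=> n; case: ifPn.
    rewrite -big_mkcond/= -[leLHS]big_filter.
    rewrite !big_const_seq !iter_addr_0 !count_predT ler_nat.
    rewrite uniq_leq_size ?filter_uniq ?iota_uniq// => n.
    by rewrite mem_filter !mem_index_iota => /andP[-> _].
  apply: le_trans (lerD sp0 (lexx _)); rewrite -big_split/=.
  rewrite big_mkcond [leRHS]big_mkcond/= !big_nat; apply: ler_sum => -[//|n] _.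
  case: ifPn => // pn; have /andP[d0 d1] := delta_bnd pn.
  have n0 : (0 : R) <= n.+1%:R `^ (- (1 + eta)) by exact: powR_ge0.
  case: ifPn => [_|]; last by rewrite -leqNgt => pn0; rewrite add0r ler_wpM2r// delta_le.
  have n1 : n.+1%:R `^ (- (1 + eta)) <= 1 :> R by apply: powR_nat_le1; lra.
  apply: ler_wpDr; first by rewrite mulr_ge0.
  by rewrite -[leRHS]mulr1 ler_pM.
rewrite /lower_cst; lra.
Qed.

Variable L : R.
Hypothesis lipschitz : forall N s h, 1 - alpha <= s <= 1 - alpha + 1 -> 0 <= h ->
  `|T N s - T N (s + h)| <= L * h.

Let L0 : 0 <= L.
Proof.
have := @lipschitz 0 (1 - alpha) 1; rewrite mulr1 => H.
by apply: le_trans (normr_ge0 _) (H _ _) => //; rewrite lexx/= lerDl.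
Qed.

(** By [prod_upper] a drift of at least [M] suffices. A finite prefix of the divergent series
    reaches [2 * M], and a small [eta] loses at most half of it. *)
Let small_prod (e : R) : 0 < e -> exists l0, forall l, (l0 <= l)%N -> exists y0,
  forall y, (y0 <= y)%N -> prod_ y (1 - alpha + l.+1%:R^-1) <= e.
Proof.
move=> e0; pose M := `|K - ln e|.
have M0 : 0 <= M by exact: normr_ge0.
have [y0 Hy0] := delta_div (2 * M).
(* This makes [eta * ln y0.+1 <= 2^-1], so [p ^ (- eta) >= 2^-1] for every prime [p < y0]. *)
exists (Num.truncn (2 * ln y0.+1%:R : R)) => l ll; exists y0 => y yy0.
pose eta : R := l.+1%:R^-1.
have eta0 : 0 < eta by rewrite invr_gt0.
have eta1 : eta <= 1 by rewrite invf_le1// ler1n.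
have etal : eta * ln y0.+1%:R <= 2^-1.
  rewrite mulrC ler_pdivrMr//.
  have : 2 * ln y0.+1%:R < l.+1%:R :> R.
    by apply: lt_le_trans (truncnS_gt _) _; rewrite ler_nat.
  lra.
have eta01 : 0 <= eta <= 1 by rewrite ltW.
apply: le_trans (prod_upper y eta01) _.
rewrite -[leRHS]lnK ?posrE// ler_expR.
suff : M <= \sum_(1 <= p < y.+1 | prime p) delta p * p%:R `^ (- (1 + eta)).
  have : K - ln e <= M by exact: ler_norm.
  lra.
have dn n : prime n -> 0 <= delta n * n%:R `^ (- (1 + eta)).
  by move=> pn; rewrite mulr_ge0 ?powR_ge0//; case/andP: (delta_bnd pn).
apply: (@le_trans _ _ (\sum_(1 <= p < y0 | prime p) delta p * p%:R `^ (- (1 + eta)))).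
  have : 2^-1 * (2 * M) <= 2^-1 * \sum_(1 <= p < y0 | prime p) delta p / p%:R.
    by rewrite ler_wpM2l// invr_ge0.
  rewrite mulrA mulVf// mul1r => /le_trans; apply; rewrite mulr_sumr.
  rewrite big_nat_cond [leRHS]big_nat_cond; apply: ler_sum => -[//|n] /andP[/andP[_ ny] pn].
  have /andP[d0 _] := delta_bnd pn.
  rewrite mulrCA ler_wpM2l// opprD powR_natD powR_inv1 ?ler0n// mulrC.
  rewrite ler_wpM2l ?invr_ge0 ?ler0n//.
  have := @powR_tangent _ 1 n.+1%:R (- eta) ltr01 (ltr0Sn _ _).
  rewrite powR1 mul1r divr1; apply: le_trans.
  have : ln n.+1%:R <= ln y0.+1%:R :> R by rewrite ler_ln ?posrE// ler_nat ltnW// ltnS ltnW.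
  nra.
case: y0 {Hy0 ll etal} yy0 => [|y0] yy0.
  by rewrite big_geq//; rewrite sumr_ge0.
rewrite [leRHS](@big_cat_nat _ _ _ y0.+1)//=; last by rewrite ltnW.
by rewrite lerDl sumr_ge0.
Qed.

Lemma euler_zero_contradiction : False.
Proof.
have /andP[c0 c1] := c_bnd.
(* The product at [k] is compared with one at some [l >= k] where it is at most [th]: in between [T]
   moves by at most [L / k.+1], and the two approximations cost [th] each. *)
have key k : expR (- lower_cst - c * ln k.+2%:R) <= L / k.+1%:R.
  apply/ler_addgt0Pr => e e0; pose th : R := e / 3.
  have th0 : 0 < th by rewrite divr_gt0.
  have [l0 Hl0] := small_prod th0.
  pose l := maxn l0 k; have [y0 Hy0] := Hl0 l (leq_maxl _ _).
  have [jk Hk] := approx k th0; have [jl Hl] := approx l th0.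
  pose j := (y0 + (jk + jl))%N.
  have jy : (y0 <= 2 ^ j)%N.
    by apply: leq_trans (ltnW (ltn_expl j (ltnSn 1))); rewrite leq_addr.
  have jjk : (jk <= j)%N by rewrite /j addnCA leq_addr.
  have jjl : (jl <= j)%N by rewrite /j addnA leq_addl.
  have {Hk} := Hk j jjk; have {Hl} := Hl j jjl; have {Hy0} := Hy0 _ jy.
  have kk : (k.+1%:R^-1 : R) <= 1 by rewrite invf_le1// ler1n.
  have kk0 : 0 < (k.+1%:R^-1 : R) by rewrite invr_gt0.
  have ll0 : 0 < (l.+1%:R^-1 : R) by rewrite invr_gt0.
  have lk : (l.+1%:R^-1 : R) <= k.+1%:R^-1 by rewrite lef_pV2 ?posrE// ler_nat ltnS leq_maxr.
  have := @prod_lower (2 ^ j) k.+1%:R^-1; rewrite kk kk0 invrK => /(_ isT).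
  rewrite [1 + _]addrC natr1.
  have := @lipschitz (2 ^ j) (1 - alpha + l.+1%:R^-1) (k.+1%:R^-1 - l.+1%:R^-1).
  have -> : 1 - alpha + l.+1%:R^-1 + (k.+1%:R^-1 - l.+1%:R^-1) =
    1 - alpha + k.+1%:R^-1 by rewrite [k.+1%:R^-1 - _]addrC addrA addrK.
  set A := prod_ _ _; set B := prod_ _ _; set A' := T _ _; set B' := T _ _.
  set lo := expR _.
  rewrite lerDl (ltW ll0) lerD2l (le_trans lk kk) subr_ge0 => /(_ isT lk).
  have : L * (k.+1%:R^-1 - l.+1%:R^-1) <= L / k.+1%:R.
    by rewrite ler_wpM2l ?L0// gerBl ltW.
  rewrite !ler_norml => h1 /andP[h2 h3] h4 h5 /andP[h6 h7] /andP[h8 h9].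
  have -> : e = th + th + th by rewrite /th; lra.
  by move: h1 h2 h3; set X := L * (_ - _); set Z := L / _; lra.
(* As [k.+2 <= 2 * k.+1], [key k] gives [k.+2 ^ (1 - c) <= 2 * L * expR lower_cst]; since [c < 1], a
   large [k] violates this. *)
pose Y := 2 * L * expR lower_cst + 1.
have Y0 : 0 < Y by rewrite ltr_wpDl// !mulr_ge0 ?L0 ?expR_ge0.
have c10 : 0 < 1 - c by rewrite subr_gt0.
pose k := Num.truncn (Y `^ (1 - c)^-1).
have kY : Y < k.+2%:R `^ (1 - c).
  have H : Y `^ (1 - c)^-1 < k.+2%:R.
    by apply: lt_trans (truncnS_gt _) _; rewrite ltr_nat.
  have := gt0_ltr_powR c10 _ _ H; rewrite -powRrM mulVf ?gt_eqF// powRr1 ?(ltW Y0)//.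
  by apply; rewrite nnegrE ?powR_ge0.
have := key k; rewrite expRD expRN.
have -> : expR (- (c * ln k.+2%:R)) = k.+2%:R `^ (- c) :> R.
  by rewrite /powR pnatr_eq0/= mulNr.
rewrite mulrC ler_pdivrMr ?expR_gt0// -mulrA [_^-1 * _]mulrC mulrA ler_pdivlMr//.
have kk : k.+2%:R <= 2 * k.+1%:R :> R by rewrite -natrM ler_nat mul2n -addnn addSnnS leq_addl.
move=> H.
have : k.+2%:R `^ (- c) * k.+2%:R <= k.+2%:R `^ (- c) * (2 * k.+1%:R).
  by rewrite ler_wpM2l ?powR_ge0.
have -> : k.+2%:R `^ (- c) * k.+2%:R = k.+2%:R `^ (1 - c) :> R.
  by rewrite addrC powR_natD powRr1 ?ler0n.
move: kY; rewrite /Y; lra.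
Qed.
End Contradiction.

(** * Almost sure bounds *)

Section AlmostSureBounds.
Context {d : measure_display} {T : measurableType d} {R : realType}.
Variables (P : probability T R) (f : nat -> {RV P >-> R}).
Variables (alpha : R) (delta : nat -> R).
Hypotheses (f_rmf : random_multiplicative f)
  (alpha_bnd : 0 < alpha < 2^-1)
  (delta_bnd : forall p : nat, prime p -> 0 <= delta p <= 1)
  (f_mean : forall p : nat, prime p ->
     ('E_P[f p] = (- (delta p / p%:R `^ alpha))%:E)%E).

Lemma Ex_rmf_prime p : prime p -> Ex P (f p) = - (delta p * p%:R `^ (- alpha)).
Proof.
by move=> pp; rewrite /Ex /Rintegral -expectation_def f_mean//= powRN.
Qed.

Lemma norm_Ex_rmf_prime p : prime p -> `|Ex P (f p)| <= p%:R `^ (- alpha).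
Proof.
move=> pp; have /andP[d0 d1] := delta_bnd pp.
rewrite Ex_rmf_prime// normrN ger0_norm ?mulr_ge0 ?powR_ge0//.
by rewrite -[leRHS]mul1r ler_wpM2r ?powR_ge0.
Qed.

Lemma partial_sum_rmf w x :
  partial_sum f w x = \sum_(0 <= n < (Num.truncn x).+1) rmf f n w.
Proof.
rewrite /partial_sum [RHS]big_ltn// {1}/rmf/= add0r !big_nat.
by apply: eq_bigr => n /andP[n0 _]; rewrite rmfE.
Qed.

Lemma ae_rmf_sum_bound g : 1 - alpha < g ->
  {ae P, forall w, exists2 K : R, 0 <= K &
    forall N, `|\sum_(0 <= n < N.+2) rmf f n w| <= K * N.+1%:R `^ g}.
Proof.
move=> ag; have /andP[a0 a1] := alpha_bnd.
pose g' := (1 - alpha + g) / 2.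
have ag' : 1 - alpha < g' by rewrite /g'; lra.
have g'0 : 0 <= g' by rewrite /g'; lra.
have e0 : 0 < g - g' by rewrite /g'; lra.
have [C C0 HC] := corr_sum_bound f_rmf alpha_bnd norm_Ex_rmf_prime ag'.
have := ae_maximal (brv_rmf f_rmf) g'0 e0 C0 HC.
by have -> : g' + (g - g') = g by ring.
Qed.

Definition centered (n : nat) (w : T) : R :=
  if prime n then f n w - Ex P (f n) else 0.

Lemma brv_centered n : brv (centered n).
Proof.
rewrite /centered; case: (boolP (prime n)) => pn; last exact: brv_cst.
by apply: brvB; [exact: brv_rmf_prime|exact: brv_cst].
Qed.

Lemma Ex_centeredM m n : m != n -> Ex P (fun w => centered m w * centered n w) = 0.
Proof.
move=> mn; rewrite /centered.
case: (boolP (prime m)) => pm; last first.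
  by under eq_fun do rewrite mul0r; exact: Ex_cst.
case: (boolP (prime n)) => pn; last first.
  by under eq_fun do rewrite mulr0; exact: Ex_cst.
have bm := brv_rmf_prime f_rmf pm; have bn := brv_rmf_prime f_rmf pn.
have Emn : Ex P (fun w => f m w * f n w) = Ex P (f m) * Ex P (f n).
  have pn' : all prime [:: n] by rewrite /= pn.
  have := Ex_rmf_mul f_rmf pm pn'; rewrite inE mn => /(_ isT).
  by under eq_fun do rewrite big_seq1; under [in RHS]eq_fun do rewrite big_seq1.
set a := Ex P (f m) in Emn *; set b := Ex P (f n) in Emn *.
have -> : (fun w => (f m w - a) * (f n w - b)) =
    (fun w => (f m w * f n w - b * f m w) - (a * f n w - a * b)).
  by apply/funext => w; ring.
rewrite !ExB ?ExZ ?Ex_cst//; do ?[exact: brv_cst|exact: brvZ|exact: brvM|apply: brvB].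
by rewrite Emn /a /b; ring.
Qed.

Lemma Ex_centered_sqr n : `|Ex P (fun w => centered n w * centered n w)| <= 4.
Proof.
rewrite ger0_norm; last first.
  by apply: Rintegral_ge0 => w _; rewrite -expr2 sqr_ge0.
rewrite -(Ex_cst P 4); apply: Ex_le; [|exact: brv_cst|].
  by apply: brvM; exact: brv_centered.
move=> w; rewrite /centered; case: ifPn => pn; last by rewrite mul0r.
have : `|Ex P (f n)| <= 1.
  apply: le_trans (norm_Ex_rmf_prime pn) _.
  have /andP[a0 _] := alpha_bnd.
  by case: n pn => // n _; apply: powR_nat_le1; lra.
rewrite ler_norml => /andP[e1 e2].
by case: (rmf_pm1 f_rmf pn w) => ->; nra.
Qed.

(** The centered variables are orthogonal with second moments at most [4], so the double sum is at
    most [4 * N.+1] and [ae_maximal] applies with exponent [2^-1]. *)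
Lemma ae_centered_sum_bound g : 2^-1 < g ->
  {ae P, forall w, exists2 K : R, 0 <= K &
    forall N, `|\sum_(0 <= n < N.+2) centered n w| <= K * N.+1%:R `^ g}.
Proof.
move=> g2; have h0 : 0 <= (2^-1 : R) by rewrite invr_ge0.
have e0 : 0 < g - 2^-1 by rewrite subr_gt0.
have HC N : \sum_(0 <= m < N.+1) \sum_(0 <= n < N.+1)
    `|Ex P (fun w => centered m w * centered n w)| <= 4 * N.+1%:R `^ (2 * 2^-1).
  rewrite mulfV// powRr1 ?ler0n// mulr_natr.
  rewrite -[X in _ *+ X]subn0 -sumr_const_nat big_nat [leRHS]big_nat.
  apply: ler_sum => m /andP[_ mN].
  rewrite (bigD1_seq m) ?mem_index_iota ?iota_uniq//= big1 ?addr0.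
    exact: Ex_centered_sqr.
  by move=> n nm; rewrite Ex_centeredM ?normr0// eq_sym.
have := ae_maximal brv_centered h0 e0 (ler0n _ 4) HC.
by have -> : 2^-1 + (g - 2^-1) = g by ring.
Qed.

Lemma ae_partial_sum_littleo :
  {ae P, forall w, forall eps : R, 0 < eps ->
     partial_sum f w =o_ +oo (fun x => x `^ (1 - alpha + eps))}.
Proof.
(* The exponents [k.+1^-1] reduce all [eps > 0] to countably many almost sure events. *)
have : {ae P, forall w, forall k : nat, exists2 K : R, 0 <= K &
    forall N, `|\sum_(0 <= n < N.+2) rmf f n w| <=
      K * N.+1%:R `^ (1 - alpha + k.+1%:R^-1)}.
  by apply: ae_foralln => k; apply: ae_rmf_sum_bound; rewrite ltrDl invr_gt0.
apply: filterS => w H eps eps0.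
pose k := Num.truncn eps^-1.
have keps : k.+1%:R^-1 < eps.
  by rewrite invf_plt ?posrE//; exact: truncnS_gt.
have [K K0 HK] := H k.
pose t := eps - k.+1%:R^-1; have t0 : 0 < t by rewrite subr_gt0.
(* Beyond this point [x ^ t >= K / e], and the maximum with [1] makes the truncation of [x]
   positive. *)
apply/eqoP => e e0; exists (Num.max 1 ((K / e) `^ t^-1)).
split; first exact: num_real.
move=> x; rewrite gt_max => /andP[x1 xK].
have x0 : 0 < x by apply: lt_trans x1.
have /andP[tx1 tx2] := truncn_itv (ltW x0).
rewrite partial_sum_rmf (ger0_norm (powR_ge0 _ _)).
case E : (Num.truncn x) tx1 tx2 => [|N] tx1 tx2.
  by have := lt_trans x1 tx2; rewrite ltxx.
have /andP[_ a1] := alpha_bnd.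
apply: le_trans (HK N) _.
apply: (@le_trans _ _ (K * x `^ (1 - alpha + k.+1%:R^-1))).
  rewrite ler_wpM2l// ge0_ler_powR ?nnegrE ?ler0n ?(ltW x0)//.
  by rewrite addr_ge0 ?invr_ge0//; lra.
have -> : 1 - alpha + eps = (1 - alpha + k.+1%:R^-1) + t by rewrite /t; ring.
rewrite [leRHS](_ : _ = e * (x `^ (1 - alpha + k.+1%:R^-1) * x `^ t)); last first.
  by rewrite -powRD// (lt0r_neq0 x0) implybT.
rewrite [leRHS]mulrCA [leLHS]mulrC ler_wpM2l ?powR_ge0// mulrC -ler_pdivrMr//.
have Ke0 : 0 <= K / e by rewrite divr_ge0// ltW.
have := gt0_ltr_powR t0 _ _ xK; rewrite -powRrM mulVf ?gt_eqF// powRr1//.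
by move=> h; apply/ltW/h; rewrite nnegrE ?powR_ge0// ltW.
Qed.

Lemma ae_partial_sum_not_littleo :
  (limf_esup (fun p => (delta p)%:E) (within [set p | prime p] \oo) < 1)%E ->
  (\sum_(0 <= p <oo | prime p) (delta p / p%:R)%:E = +oo)%E ->
  {ae P, forall w, forall eps : R, 0 < eps ->
     ~ (partial_sum f w =o_ +oo (fun x => x `^ (1 - alpha - eps)))}.
Proof.
move=> dlim ddiv; have /andP[a0 a1] := alpha_bnd.
(* An upper limit below [1] yields a set of the filter on which the supremum of [delta] is already
   below [1]. *)
have [c c01 [p0 Hc]] : exists2 c : R, 0 <= c < 1 &
    exists p0, forall p, prime p -> (p0 <= p)%N -> delta p <= c.
  move: dlim => /ereal_inf_lt[_ [A [p0 _ HA] <-]] supA.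
  have dA p : prime p -> (p0 <= p)%N ->
      ((delta p)%:E <= ereal_sup [set (delta p)%:E | p in A])%E.
    by move=> pp pp0; apply: ereal_sup_ubound; exists p => //; exact: HA.
  move: supA dA; case: (ereal_sup _) => [r| |]//.
    rewrite lte_fin => r1 dA; exists (Num.max 0 r).
      by rewrite le_max lexx/= gt_max ltr01.
    by exists p0 => p pp pp0; rewrite le_max orbC -lee_fin dA.
  move=> _ dA; exists 0; first by rewrite lexx ltr01.
  by exists p0 => p pp pp0; have := dA p pp pp0; rewrite leNgt ltNye.
have dpos p : prime p -> 0 <= delta p / p%:R.
  by move=> pp; rewrite divr_ge0//; case/andP: (delta_bnd pp).
have Hdiv (M : R) : exists y, M <= \sum_(1 <= p < y | prime p) delta p / p%:R.
  apply: contrapT => /forallNP Hn; move: ddiv; apply/eqP; rewrite lt_eqF//.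
  apply: (@le_lt_trans _ _ M%:E); last exact: ltry.
  apply: lime_le; first by apply: is_cvg_nneseries => n _ pn; rewrite lee_fin dpos.
  apply: nearW => n; rewrite sumEFin lee_fin; apply: ltW; rewrite ltNge; apply/negP.
  move=> Mn; apply: (Hn n); apply: le_trans Mn _.
  by case: n => [|n]; [rewrite !big_geq|rewrite big_ltn_cond].
(* Above [2^-1] the centered sums are almost surely [O(N ^ b)]; below [1 - alpha] Abel summation
   bounds their Dirichlet series down to [s = 1 - alpha]. *)
pose b := (2^-1 + (1 - alpha)) / 2.
have b2 : 2^-1 < b by rewrite /b; lra.
have ba : b < 1 - alpha by rewrite /b; lra.
have H2 : {ae P, forall w, forall k : nat, forall e : R, 0 < e ->
    exists j0, forall j, (j0 <= j)%N ->
   `|\prod_(1 <= p < (2 ^ j).+1 | prime p)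
       (1 + f p w * p%:R `^ (- (1 - alpha + k.+1%:R^-1))) -
     \sum_(1 <= n < (2 ^ j).+1)
       rmf f n w * n%:R `^ (- (1 - alpha + k.+1%:R^-1))| <= e}.
  (* Restricting to countably many exponents keeps the exceptional set null. *)
  apply: ae_foralln => k.
  apply: (euler_approximation f_rmf alpha_bnd norm_Ex_rmf_prime).
  by rewrite ltrDl invr_gt0.
apply: filterS2 (ae_centered_sum_bound b2) H2 => w [C C0 HC] Happ eps eps0.
move=> /eqoP/(_ 1 ltr01)[A [_ HA]].
have s00 : 0 <= 1 - alpha by lra.
have [K HK] : exists K : R, forall N s, 1 - alpha <= s <= 1 - alpha + 1 ->
    `|\sum_(1 <= n < N) centered n w * n%:R `^ (- s)| <= K.
  apply: (@abel_powR _ (fun n => centered n w) b (1 - alpha) C) => // n.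
  by have := HC n; rewrite big_ltn// {1}/centered/= add0r.
have [D D0 HD] : exists2 D : R, 0 <= D & forall n,
    `|\sum_(1 <= i < n.+2) rmf f i w| <= D * n.+1%:R `^ (1 - alpha - eps).
  pose M n : R := \sum_(1 <= i < n.+2) rmf f i w.
  have ME n : partial_sum f w n.+1%:R = M n.
    by rewrite partial_sum_rmf natrK big_ltn// {1}/rmf/= add0r.
  (* The asymptotic bound holds only beyond [A]; the finitely many earlier ratios are added to its
     constant [1]. *)
  pose n0 := Num.truncn `|A|; pose u n : R := `|M n| / n.+1%:R `^ (1 - alpha - eps).
  have u0 n : 0 <= u n by rewrite divr_ge0 ?powR_ge0.
  exists (1 + \sum_(0 <= n < n0.+1) u n); first by rewrite addr_ge0// sumr_ge0.
  move=> n; rewrite -/(M n) -ler_pdivrMr ?powR_nat_gt0// -/(u n).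
  have [nn|nn] := ltnP n n0.+1.
    rewrite ler_wpDl//.
    by rewrite (bigD1_seq n) ?mem_index_iota ?iota_uniq//= lerDl sumr_ge0.
  apply: ler_wpDr; first by rewrite sumr_ge0.
  rewrite ler_pdivrMr ?powR_nat_gt0//.
  have := HA n.+1%:R; rewrite ME (ger0_norm (powR_ge0 _ _)); apply.
  apply: le_lt_trans (ler_norm A) _; apply: lt_le_trans (truncnS_gt _) _.
  by rewrite ler_nat ltnW.
have eb : 1 - alpha - eps < 1 - alpha by lra.
have [L HL] := abel_powR_lipschitz D0 s00 eb HD.
apply: (@euler_zero_contradiction R alpha delta (fun p => f p w)
  (fun N s => \sum_(1 <= n < N.+1) rmf f n w * n%:R `^ (- s))
  alpha_bnd delta_bnd _ K _ c p0 c01 Hc Hdiv Happ L).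
- by move=> p pp; rewrite expr2 sqr_rmf_prime.
- move=> N s sb; apply: le_trans (HK N s sb); rewrite le_eqVlt; apply/orP; left.
  apply/eqP; congr `|_|; apply: eq_bigr => n _; rewrite /centered.
  by case: ifPn => // pn; rewrite Ex_rmf_prime// opprK.
- move=> N s h sb h0; apply: le_trans (HL N.+1 s h sb h0); rewrite -sumrB.
  by under eq_bigr do rewrite -mulrBr.
Qed.
End AlmostSureBounds.

Theorem theorem1p5 (d : measure_display) (T : measurableType d) (R : realType)
    (P : probability T R) (f : nat -> {RV P >-> R})
    (alpha : R) (delta : nat -> R)
    (f_rmf : random_multiplicative f)
    (f_wbiased : weakly_biased f)
    (alpha_bnd : 0 < alpha < 2^-1)
    (delta_bnd : forall p : nat, prime p -> 0 <= delta p <= 1)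
    (f_mean : forall p : nat, prime p ->
       ('E_P[f p] = (- (delta p / p%:R `^ alpha))%:E)%E) :
  {ae P, forall w, forall eps : R, 0 < eps ->
     partial_sum f w =o_ +oo (fun x => x `^ (1 - alpha + eps))}
  /\
  ((limf_esup (fun p => (delta p)%:E) (within [set p | prime p] \oo) < 1)%E ->
   (\sum_(0 <= p <oo | prime p) (delta p / p%:R)%:E = +oo)%E ->
   {ae P, forall w, forall eps : R, 0 < eps ->
      ~ (partial_sum f w =o_ +oo (fun x => x `^ (1 - alpha - eps)))}).
Proof.
have lo := ae_partial_sum_littleo f_rmf alpha_bnd delta_bnd f_mean.
split => // dlim ddiv.
exact: (ae_partial_sum_not_littleo f_rmf alpha_bnd delta_bnd f_mean dlim ddiv).
Qed.
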